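(* Let $\psi$ be the wavelet of an orthonormal multiresolution analysis of $L^2(\mathbb{R})$, let $N\in\mathbb{N}$, $N\ge 2$, be its number of vanishing moments, and let $h_2:\mathbb{R}\to\mathbb{C}$ and $d\in\mathbb{R}$. Suppose the following. (1) $h_2(x)=\overline{h_2(-x)}$ and $h_2,h_2^{-1}\in C^2(\mathbb{R})$. (2) For any $\epsilon>0$ there are constants $C_2\ge C_1>0$ and $C_3>0$ (depending on $\epsilon$) such that $$C_1|x|^{-d}\le |h_2(x)|\le C_2|x|^{-d},\quad |x|>\epsilon,$$ $$\Big|\frac{d^k}{dx^k}(h_2)^p(x)\Big|\le C_3|x|^{-pd-k},\quad p=-1,1,\ k=1,2,\ |x|>\epsilon,$$ $$\max_{p=-1,1}\ \max_{k=0,1,2}\ \frac{1}{2^{-pjd}}\,2^{jk}\Big|\frac{d^k}{dx^k}(h_2)^p(2^jx)\Big|\le \frac{C_3}{|x|^{N-2}},\quad j\ge 1,\ |x|\le\epsilon.$$ (3) $|\psi(t)|=O((1+t^2)^{-N/2-1})$, $\int_{\mathbb{R}}t^\nu\psi(t)\,dt=0$ for $\nu=0,1,\dots,N-1$, and $N\ge\max\{2,-\tfrac12+|d|\}$. (4) $\widehat\psi\in C^N(\mathbb{R})$. (5) There exist $\eta>0$ and $C>0$ such that $\max_{k=0,1,2}\big|\frac{d^k}{dx^k}\widehat\psi(x)\big|\le \frac{C}{(1+|x|)^{|d|+(2+\eta)}}$ for $x\in\mathbb{R}$. Then both families of functions $\{\Psi_{j,k},\ j\ge 0,\ k\in\mathbb{Z}\}$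 and $\{\Psi^{j,k},\ j\ge 0,\ k\in\mathbb{Z}\}$ are vaguelets.
   Context: Fourier transform convention: $\widehat f(x)=\int_{\mathbb{R}}e^{-ixt}f(t)\,dt$. $\|\cdot\|$ is the $L^2(\mathbb{R})$ norm. $\psi_{j,k}(t)=2^{j/2}\psi(2^jt-k)$. A multiresolution analysis (MRA) has a scaling function $\phi$ and a wavelet $\psi$ such that $\{\phi(t-k),\,2^{j/2}\psi(2^jt-k),\ j\ge0,\ k\in\mathbb{Z}\}$ is an orthonormal basis of $L^2(\mathbb{R})$. The functions are $\Psi_{j,k}=\Psi^{\#}_{j,k}/\|\Psi^{\#}_{j,k}\|$ with $\widehat\Psi^{\#}_{j,k}(x)=h_2(x)\widehat\psi_{j,k}(x)$, and $\Psi^{j,k}=\Psi_{\#}^{j,k}/\|\Psi_{\#}^{j,k}\|$ with $\widehat\Psi_{\#}^{j,k}(x)=\overline{h_2(x)^{-1}}\,\widehat\psi_{j,k}(x)$. In hypothesis (2), $\frac{d^k}{dx^k}(h_2)^p(2^jx)$ means the $k$-th derivative of $(h_2)^p$ evaluated at $2^jx$ (not the derivative of $x\mapsto (h_2)^p(2^jx)$); when $N>2$ the right-hand side $C_3/|x|^{N-2}$ at $x=0$ is read as $+\infty$. A family $\{f_{j,k}\}$ is called vaguelets if there are constants $C$ (not depending on $j,k$) and $0<\alpha_2<\alpha_1<1$ such that for all $j,k$ and all $t,t'\in\mathbb{R}$: $|f_{j,k}(t)|\le C2^{j/2}(1+|2^jt-k|)^{-1-\alpha_1}$; $\int_{\mathbb{R}}f_{j,k}(t)\,dt=0$;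 and $|f_{j,k}(t)-f_{j,k}(t')|\le C2^{j(1/2+\alpha_2)}|t-t'|^{\alpha_2}$. *)

(* Defs.v *)
From HB Require Import structures.
From mathcomp Require Import all_boot all_order all_algebra.
From mathcomp Require Import all_classical all_reals all_analysis.
From mathcomp Require Import complex.

Set Implicit Arguments.
Unset Strict Implicit.
Unset Printing Implicit Defensive.

Import Order.TTheory GRing.Theory Num.Theory.
Import numFieldNormedType.Exports.
Import ComplexField.Normc.

Local Open Scope classical_set_scope.
Local Open Scope complex_scope.
Local Open Scope ring_scope.

(* Smoothness, derivatives and integrals of functions R -> R[i] are taken on
   real and imaginary parts; the real-valued modulus on R[i] is [normc]. *)
Section ComplexValued.
Context {R : realType}.
Local Notation Re := (@complex.Re R).
Local Notation Im := (@complex.Im R).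
Implicit Types (f g : R -> R[i]) (n : nat).

Definition classC n f : Prop :=
  forall u : R -> R, u = Re \o f \/ u = Im \o f ->
    (forall m x, (m < n)%N -> derivable (derive1n m u) x 1) /\
    continuous (derive1n n u).

Definition cderive n f (x : R) : R[i] :=
  derive1n n (Re \o f) x +i* derive1n n (Im \o f) x.

Definition cintegrable f : Prop :=
  lebesgue_measure.-integrable [set: R] (EFin \o (Re \o f)) /\
  lebesgue_measure.-integrable [set: R] (EFin \o (Im \o f)).

Definition cintegral f : R[i] :=
  (\int[lebesgue_measure]_t Re (f t)) +i* (\int[lebesgue_measure]_t Im (f t)).

Definition L2 : set (R -> R[i]) := [set f : R -> R[i] |
  Re \o f \in Lfun (@lebesgue_measure R) 2%:E /\
  Im \o f \in Lfun (@lebesgue_measure R) 2%:E].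

Definition L2norm f : R :=
  fine (Lnorm (@lebesgue_measure R) 2%:E (fun t => (normc (f t))%:E)).

Definition L2dist f g : R := L2norm (fun t => f t - g t).

Definition L2inner f g : R[i] := cintegral (fun t => f t * conjc (g t)).

Definition expi (y : R) : R[i] := cos y +i* sin y.

Definition fourier f (x : R) : R[i] :=
  cintegral (fun t => expi (- (x * t)) * f t).

(* The function with Fourier transform [g], as the (unique if it exists)
   continuous integrable [f] such that [fourier f = g]. When there is none,
   the value is a jump function, so that no regularity can come from it. *)
Definition inv_fourier (g : R -> R[i]) : R -> R[i] :=
  xget (fun t => (\1_(`[0, 1]%classic : set R) t)%:C)
    [set f : R -> R[i] |
      [/\ classC 0 f, cintegrable f & forall x, fourier f x = g x]].

Definition normalize f (t : R) : R[i] := f t / (L2norm f)%:C.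

Definition translate f (k : int) (t : R) : R[i] := f (t - k%:~R).

Definition dyadic f (j : nat) (k : int) (t : R) : R[i] :=
  (2 `^ (j%:R / 2))%:C * f (2 ^+ j * t - k%:~R).

Definition orthonormal_basis (I : eqType) (e : I -> R -> R[i])
    (V : set (R -> R[i])) : Prop :=
  [/\ forall i, V (e i),
      forall i i', L2inner (e i) (e i') = (i == i')%:R &
      forall f (eps : R), V f -> 0 < eps ->
        exists (s : seq I) (c : I -> R[i]),
          L2dist f (fun t => \sum_(i <- s) c i * e i t) < eps].

Definition closed_subspace (V : set (R -> R[i])) : Prop :=
  [/\ V `<=` L2,
      V (fun=> 0),
      forall (a : R[i]) f g, V f -> V g -> V (fun t => a * f t + g t) &
      forall f, L2 f ->
        (forall eps : R, 0 < eps -> exists2 g, V g & L2dist f g < eps) -> V f].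

Definition multiresolution (V : int -> set (R -> R[i])) (phi : R -> R[i])
    : Prop :=
  [/\ forall j, closed_subspace (V j) /\ V j `<=` V (j + 1),
      forall j f, V j f <-> V (j + 1) (fun t => f (2 * t)),
      forall f, (forall j, V j f) -> L2norm f = 0,
      forall f (eps : R), L2 f -> 0 < eps ->
        (exists j, exists2 g, V j g & L2dist f g < eps) &
      orthonormal_basis (translate phi) (V 0)].

Definition mra_wavelet (psi : R -> R[i]) : Prop :=
  exists (V : int -> set (R -> R[i])) (phi : R -> R[i]),
    [/\ multiresolution V phi,
        V 1 psi &
        orthonormal_basis
          (fun i : int + nat * int =>
             match i with
             | inl k => translate phi k
             | inr (j, k) => dyadic psi j k
             end) L2].

Definition vaguelets (F : nat -> int -> R -> R[i]) : Prop :=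
  exists C a1 a2 : R,
    [/\ 0 < a2, a2 < a1, a1 < 1 &
     forall (j : nat) (k : int),
     [/\ forall t, normc (F j k t) <=
           C * 2 `^ (j%:R / 2) * (1 + `|2 ^+ j * t - k%:~R|) `^ (- 1 - a1),
         cintegral (F j k) = 0 &
         forall t t', normc (F j k t - F j k t') <=
           C * 2 `^ (j%:R * (2^-1 + a2)) * `|t - t'| `^ a2]].

Definition Psi_lower (h2 psi : R -> R[i]) (j : nat) (k : int) : R -> R[i] :=
  normalize (inv_fourier (fun x => h2 x * fourier (dyadic psi j k) x)).

Definition Psi_upper (h2 psi : R -> R[i]) (j : nat) (k : int) : R -> R[i] :=
  normalize
    (inv_fourier (fun x => conjc (h2 x)^-1 * fourier (dyadic psi j k) x)).

End ComplexValued.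

(* Main.v *)
Require Import Defs.
From HB Require Import structures.
From mathcomp Require Import all_boot all_order all_algebra.
From mathcomp Require Import all_classical all_reals all_analysis.
From mathcomp Require Import measurable_realfun complex ring lra.

Set Implicit Arguments.
Unset Strict Implicit.
Unset Printing Implicit Defensive.

Import Order.TTheory GRing.Theory Num.Theory.
Import numFieldNormedType.Exports.
Import ComplexField.Normc.

Local Open Scope classical_set_scope.
Local Open Scope complex_scope.
Local Open Scope ring_scope.

(** Both families arise from one multiplier [H] of growth [`|x| `^ (- e)]: [h2] with
    [e = d], and the conjugate of the inverse of [h2] with [e = - d].  Substituting
    [x = 2 ^+ j * y] shows that, up to a positive constant, the function of index
    [(j, k)] is the dyadic dilate of a profile [G j] with Fourier transform
    [M j y = 2 `^ (j%:R * e) * H (2 ^+ j * y) * fourier psi y].  Normalization removes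
    the constant and the vaguelet conditions are invariant under dilation, so it
    suffices to bound the profiles uniformly in [j] ([vaguelets_of_profiles]):
    decay like [(1 + t ^+ 2)^-1], Hoelder continuity, vanishing integral, and an L2
    norm bounded away from 0.

    The essential estimate is that [M j] and its first two derivatives are
    uniformly bounded by an integrable function ([rescaled_product_bound]).  Away
    from 0 the decay of [fourier psi] beats the growth of [H].  Near 0 the rescaled
    multiplier may be as large as [`|y| ^- (N - 2)], but the vanishing moments make
    [fourier psi] vanish to order [N] ([fourier_flat0], [flat_derive1n]), so its
    derivatives up to the second are [O(`|y| ^+ (N - 2))].  Two integrations by parts
    then give the decay of the profile ([trigT_decay]); a moment of small order of
    [M j] gives its Hoelder continuity ([trigT_holder]); its integral is
    [M j 0 = 0].  For the norm, fix [y0] with [fourier psi y0 != 0]: the lower bound on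
    [H] keeps [M j y0] away from 0, this value is bounded by the L1 norm of the
    profile, and thanks to the decay a small L2 norm would force a small L1 norm
    ([L2norm_lower]).

    Fourier inversion for continuous functions is used both to see that the
    transform of the profile is [M j] and that the profile is the only continuous
    integrable function with that property.  It is proved by Abel summation
    ([fourier_inversion]): damping by [expR (- `|e * y|)] turns the inverse transform
    into the convolution with a Poisson kernel, which is an approximate
    identity. *)

(** * Integrals over the real line *)

Section RealLine.
Context {R : realType}.
Local Notation mu := (@lebesgue_measure R).
Implicit Types (f g : R -> R) (a b x y : R).

Definition L1 f := mu.-integrable [set: R] (EFin \o f).

Lemma L1_measurable f : L1 f -> measurable_fun setT f.
Proof. by move=> /integrableP[/measurable_EFinP]. Qed.

Lemma eq_L1 f g : f =1 g -> L1 f -> L1 g.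
Proof. by move=> /funext ->. Qed.

Lemma L1_le f g : measurable_fun setT f -> L1 g ->
  (forall x, `|f x| <= g x) -> L1 f.
Proof.
move=> mf ig fg; apply: le_integrable ig => //; first exact/measurable_EFinP.
move=> x _ /=; rewrite lee_fin (le_trans (fg x))//; exact: ler_norm.
Qed.

Lemma L1Zl c f : L1 f -> L1 (fun x => c * f x).
Proof. by move=> /(integrableZl measurableT c). Qed.

Lemma L1D f g : L1 f -> L1 g -> L1 (fun x => f x + g x).
Proof. by move=> fi gi; have := integrableD measurableT fi gi. Qed.

Lemma L1N f : L1 f -> L1 (fun x => - f x).
Proof. by move=> fi; have := integrableN fi. Qed.

Lemma L1B f g : L1 f -> L1 g -> L1 (fun x => f x - g x).
Proof. by move=> fi gi; have := L1D fi (L1N gi). Qed.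

Lemma L1_norm f : L1 f -> L1 (fun x => `|f x|).
Proof. exact: integrable_norm. Qed.

Lemma L1_bddM f g c : measurable_fun setT f -> (forall x, `|f x| <= c) ->
  L1 g -> L1 (fun x => f x * g x).
Proof.
move=> mf fc ig; apply: (@L1_le _ (fun x => c * `|g x|)).
- apply: measurable_funM => //; exact: L1_measurable ig.
- exact/L1Zl/L1_norm.
- by move=> x; rewrite normrM ler_wpM2r.
Qed.

Lemma intZl c f : L1 f -> \int[mu]_x (c * f x) = c * \int[mu]_x f x.
Proof. exact: RintegralZl. Qed.

Lemma intD f g : L1 f -> L1 g ->
  \int[mu]_x (f x + g x) = \int[mu]_x f x + \int[mu]_x g x.
Proof. exact: RintegralD. Qed.

Lemma intN f : L1 f -> \int[mu]_x (- f x) = - \int[mu]_x f x.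
Proof.
move=> fi; rewrite -mulN1r -intZl//.
by apply: eq_Rintegral => x _; rewrite mulN1r.
Qed.

Lemma intB f g : L1 f -> L1 g ->
  \int[mu]_x (f x - g x) = \int[mu]_x f x - \int[mu]_x g x.
Proof. exact: RintegralB. Qed.

Lemma eq_int f g : f =1 g -> \int[mu]_x f x = \int[mu]_x g x.
Proof. by move=> /funext ->. Qed.

Lemma int0 : \int[mu]_(x in [set: R]) (0 : R) = 0.
Proof. by rewrite /Rintegral integral0. Qed.

Lemma le_int f g : L1 f -> L1 g -> (forall x, f x <= g x) ->
  \int[mu]_x f x <= \int[mu]_x g x.
Proof. by move=> fi gi fg; apply: le_Rintegral. Qed.

Lemma norm_int_le f g : measurable_fun setT f -> L1 g ->
  (forall x, `|f x| <= g x) -> `|\int[mu]_x f x| <= \int[mu]_x g x.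
Proof.
move=> mf gi fg; have fi := L1_le mf gi fg.
apply: (le_trans (le_normr_Rintegral _ fi)) => //.
by apply: le_int => //; exact: L1_norm.
Qed.

(** Lebesgue measure is determined by its values on bounded intervals, and the
    preimage of an interval under [x |-> a * x + b] has its length divided by
    [`|a|]. *)
Lemma ge0_integral_affine a b (f : R -> \bar R) : a != 0 ->
  measurable_fun setT f -> (forall x, 0 <= f x)%E ->
  (\int[mu]_x f x = `|a|%:E * \int[mu]_x f (a * x + b)%R)%E.
Proof.
move=> a0 mf f0.
pose phi := (fun x => a * x + b) : measurableTypeR R -> measurableTypeR R.
have mphi : measurable_fun [set: measurableTypeR R] phi.
  by apply: measurable_funD => //; exact: measurable_funM.
have [nu nuE] : exists nu : {measure set (measurableTypeR R) -> \bar R},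
    nu = pushforward mu phi :> (set _ -> _).
  by unshelve eexists (pushforward mu phi : {measure set _ -> \bar R}).
pose c := NngNum (normr_ge0 a).
have E A : measurable A -> mu A = mscale c nu A.
  apply: lebesgue_measure_unique => X [[u v]/= _ <-].
  rewrite /mscale nuE /pushforward /=.
  have [a_gt0|a_le0] := ltP 0 a.
  - have -> : phi @^-1` [set x | x \in `]u, v]] = `](u - b) / a, (v - b) / a]%classic.
      apply/seteqP; split => x /=; rewrite !in_itv/= ltr_pdivrMr// ler_pdivlMr// /phi;
      rewrite ltrBlDr lerBrDr (mulrC a) //.
    rewrite !lebesgue_measure_itv/= !lte_fin ltr_pM2r ?invr_gt0// ltrD2r.
    case: ifPn; last by rewrite mule0.
    by rewrite -!EFinB -EFinM (gtr0_norm a_gt0) => _; congr EFin; field.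
  - have {}a_lt0 : a < 0 by rewrite lt_neqAle a0.
    have -> : phi @^-1` [set x | x \in `]u, v]] = `[(v - b) / a, (u - b) / a[%classic.
      apply/seteqP; split => x /=; rewrite !in_itv/= ltr_ndivlMr// ler_ndivrMr// /phi;
      by rewrite ltrBlDr lerBrDr (mulrC a) andbC.
    rewrite !lebesgue_measure_itv/= !lte_fin ltr_nM2r ?invr_lt0// ltrD2r.
    case: ifPn; last by rewrite mule0.
    by rewrite -!EFinB -EFinM (ltr0_norm a_lt0) => _; congr EFin; field.
transitivity (\int[mscale c nu]_(x in [set: measurableTypeR R]) f x)%E.
  by apply: eq_measure_integral => A mA _; exact: E.
rewrite ge0_integral_mscale//; congr (_ * _)%E.
by rewrite nuE ge0_integral_pushforward.
Qed.

Lemma L1_affine a b f : a != 0 -> L1 f -> L1 (fun x => f (a * x + b)).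
Proof.
move=> a0 /[dup] /L1_measurable mf /integrableP[_ foo].
have maf : measurable_fun setT (fun x => a * x + b).
  by apply: measurable_funD => //; exact: measurable_funM.
apply/integrableP; split.
  by apply/measurable_EFinP; exact: (measurableT_comp mf maf).
move: foo; rewrite (@ge0_integral_affine a b)//; last first.
  by apply/measurable_EFinP; exact: (measurableT_comp (@normr_measurable _ _) mf).
rewrite /=; set I := (X in (_ -> X < _)%E).
rewrite -[X in (_ * X)%E]/I; case: I => [r| |] //=; first by rewrite !ltry.
by rewrite gt0_muley// lte_fin normr_gt0.
Qed.

Lemma int_affine a b f : a != 0 -> L1 f ->
  \int[mu]_x f x = `|a| * \int[mu]_x f (a * x + b).
Proof.
move=> a0 fi.
have E p : L1 p -> (forall t, 0 <= p t) -> \int[mu]_x p x = `|a| * \int[mu]_x p (a * x + b).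
  move=> ip p0; rewrite /Rintegral (@ge0_integral_affine a b (EFin \o p))//; last first.
    by apply/measurable_EFinP; exact: L1_measurable ip.
  rewrite fineM//.
  exact: integrable_fin_num (L1_affine b a0 ip).
have pos g : L1 g -> L1 g^\+ by exact: integrable_funrpos.
have neg g : L1 g -> L1 g^\- by exact: integrable_funrneg.
have E2 g : L1 g -> \int[mu]_x g x = \int[mu]_x g^\+ x - \int[mu]_x g^\- x.
  move=> ig; rewrite -intB; [|exact: pos|exact: neg].
  by apply: eq_int => x; rewrite -[in LHS](funrposBneg g).
rewrite (E2 f fi) (E2 _ (L1_affine b a0 fi)) mulrBr (E f^\+) ?(E f^\-)//;
  [exact: neg|exact: pos].
Qed.

End RealLine.

(** * Integrating derivatives over the line *)

Section FTC.
Context {R : realType}.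
Local Notation mu := (@lebesgue_measure R).
Implicit Types (f g F : R -> R) (a b c x y l : R).

Lemma der_eq f x a b : is_derive x 1 f a -> a = b -> is_derive x 1 f b.
Proof. by move=> + <-. Qed.

Lemma derD f g x a b : is_derive x 1 f a -> is_derive x 1 g b ->
  is_derive x 1 (fun y => f y + g y) (a + b).
Proof. by move=> df dg; exact: (is_deriveD df dg). Qed.

Lemma derB f g x a b : is_derive x 1 f a -> is_derive x 1 g b ->
  is_derive x 1 (fun y => f y - g y) (a - b).
Proof. by move=> df dg; exact: (is_deriveB df dg). Qed.

Lemma derN f x a : is_derive x 1 f a -> is_derive x 1 (fun y => - f y) (- a).
Proof. by move=> df; exact: (is_deriveN df). Qed.

Lemma derZ c f x a : is_derive x 1 f a -> is_derive x 1 (fun y => c * f y) (c * a).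
Proof. by move=> df; exact: (is_deriveZ c df). Qed.

Lemma derM f g x a b : is_derive x 1 f a -> is_derive x 1 g b ->
  is_derive x 1 (fun y => f y * g y) (a * g x + f x * b).
Proof.
move=> df dg; apply: der_eq (is_deriveM df dg) _.
by rewrite addrC /GRing.scale/= (mulrC (g x)).
Qed.

Lemma der_comp f g x a b : is_derive (g x) 1 f a -> is_derive x 1 g b ->
  is_derive x 1 (fun y => f (g y)) (a * b).
Proof. by move=> df dg; exact: (is_derive1_comp df dg). Qed.

Lemma der_id x : is_derive x 1 (fun y => y) (1 : R).
Proof. exact: is_derive_id. Qed.

Lemma der_cst c x : is_derive x 1 (fun=> c) (0 : R).
Proof. exact: is_derive_cst. Qed.

Lemma der_continuous f df : (forall x, is_derive x 1 f (df x)) -> continuous f.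
Proof.
by move=> dF x; have d := dF x; exact/differentiable_continuous/derivable1_diffP.
Qed.

(** The function [g] need not be smooth at 0: an antiderivative is only required
    for the function [h] that represents it on the positive half-line. *)
Lemma ge0_even_integral g h F l : continuous g -> (forall x, 0 <= g x) ->
  (forall x, g (- x) = g x) -> (forall x, 0 <= x -> g x = h x) ->
  (forall x, is_derive x 1 F (h x)) -> F x @[x --> +oo] --> l ->
  (\int[mu]_x (g x)%:E = (2 * (l - F 0))%:E)%E.
Proof.
move=> cg g0 eg gh dF Fl.
have cF : continuous F := der_continuous dF.
rewrite (@ge0_symfun_integralT _ g)//; last by move=> x /=; rewrite eg.
rewrite -set_itvcy (@ge0_continuous_FTC2y _ g F 0 l)//.
- exact: continuous_subspaceT.
- by apply: cvg_at_right_filter; exact: cF.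
- move=> x; rewrite in_itv/= andbT => x0.
  by rewrite derive1E gh ?ltW//; have dFx := dF x; rewrite derive_val.
Qed.

Lemma ge0_L1 f l : measurable_fun setT f -> (forall x, 0 <= f x) ->
  (\int[mu]_x (f x)%:E = l%:E)%E -> L1 f /\ \int[mu]_x f x = l.
Proof.
move=> mf f0 fl; split; last by rewrite /Rintegral fl.
apply/integrableP; split; first exact/measurable_EFinP.
under eq_integral do rewrite /= ger0_norm//.
by rewrite fl ltry.
Qed.

(** Symmetrizing reduces the line to a half-line: [f x + f (- x)] is even with
    antiderivative [F x - F (- x)]. *)
Lemma ge0_int_derive f F l : continuous f -> (forall x, 0 <= f x) ->
  (forall x, is_derive x 1 F (f x)) ->
  F x - F (- x) @[x --> +oo] --> l ->
  L1 f /\ \int[mu]_x f x = l.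
Proof.
move=> cf f0 dF Fl.
have mf : measurable_fun setT f by exact: continuous_measurable_fun.
have cfN : continuous (fun x => f (- x)).
  by move=> x; apply: (@continuous_comp _ _ _ (fun x => - x) f);
    [exact: opp_continuous|exact: cf].
have mfN : measurable_fun setT (fun x => f (- x)) by exact: continuous_measurable_fun.
pose g x := f x + f (- x); pose G x := F x - F (- x).
have cg : continuous g.
  by move=> x; apply: cvgD; [exact: cf|exact: cfN].
have dG x : is_derive x 1 G (g x).
  have dFx := dF x; have dFNx := dF (- x).
  by apply: der_eq (derB dFx (der_comp dFNx (derN (der_id x)))) _; rewrite mulrN1 opprK.
have E2 : (\int[mu]_x (g x)%:E = (2 * l)%:E)%E.
  rewrite (@ge0_even_integral g g G l)//.
  - by rewrite /G oppr0 subrr subr0.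
  - by move=> x; rewrite /g addr_ge0.
  - by move=> x; rewrite /g opprK addrC.
have E3 : (\int[mu]_x (g x)%:E = \int[mu]_x (f x)%:E + \int[mu]_x (f x)%:E)%E.
  under eq_integral do rewrite EFinD.
  rewrite ge0_integralD//=; first last.
  - exact/measurable_EFinP.
  - by move=> x _; rewrite lee_fin.
  - exact/measurable_EFinP.
  - by move=> x _; rewrite lee_fin.
  congr (_ + _)%E.
  rewrite [RHS](@ge0_integral_affine _ (-1) 0 (EFin \o f))//=.
  - rewrite normrN1 mul1e; apply: eq_integral => x _.
    by rewrite mulN1r addr0.
  - exact/measurable_EFinP.
apply: ge0_L1 => //.
move: E2; rewrite E3; have : (0 <= \int[mu]_x (f x)%:E)%E.
  by apply: integral_ge0 => x _; rewrite lee_fin.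
case: (\int[mu]_x (f x)%:E)%E => [r| |]//= _.
by rewrite -EFinD => -[H]; congr EFin; lra.
Qed.

(** The majorant in terms of which integrability and decay are expressed; its
    antiderivative is [atan]. *)
Definition lorentz x : R := (1 + x ^+ 2)^-1.

Lemma lorentz_gt0 x : 0 < lorentz x.
Proof. by rewrite invr_gt0 ltr_pwDl// sqr_ge0. Qed.

Lemma lorentz_ge0 x : 0 <= lorentz x. Proof. exact/ltW/lorentz_gt0. Qed.

Lemma lorentz_le1 x : lorentz x <= 1.
Proof. by rewrite invf_le1 ?lerDl ?sqr_ge0// ltr_pwDl// sqr_ge0. Qed.

Lemma continuous_lorentz : continuous lorentz.
Proof. exact: continuous_oneDsqrV. Qed.

Lemma lorentz_integral : L1 lorentz /\ \int[mu]_x lorentz x = pi.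
Proof.
apply: (@ge0_int_derive _ atan).
- exact: continuous_lorentz.
- exact: lorentz_ge0.
- under eq_fun do rewrite atanN opprK.
  rewrite (_ : pi = pi / 2 + pi / 2); last by field.
  by apply: cvgD; exact: cvgy_atan.
Qed.

Lemma L1_lorentz : L1 lorentz. Proof. exact: lorentz_integral.1. Qed.

Lemma cvgy_lorentz : lorentz x @[x --> +oo] --> (0 : R).
Proof.
apply/cvgrPdist_le => /= e e0; near=> x.
have x1 : 1 <= x by near: x; apply: nbhs_pinfty_ge; exact: num_real.
have xe : e^-1 <= x by near: x; apply: nbhs_pinfty_ge; exact: num_real.
rewrite sub0r normrN ger0_norm ?lorentz_ge0// /lorentz.
rewrite invf_ple ?posrE ?ltr_pwDl ?sqr_ge0//.
by rewrite (le_trans xe)//; nra.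
Unshelve. all: end_near. Qed.

(** Adding a large multiple of [lorentz] makes the derivative nonnegative, so that
    [ge0_int_derive] applies. *)
Lemma int_derive0 f F K : continuous f -> (forall x, is_derive x 1 F (f x)) ->
  (forall x, `|f x| <= K * lorentz x) -> (forall x, `|F x| <= K * lorentz x) ->
  \int[mu]_x f x = 0.
Proof.
move=> cf dF fK FK.
pose g x := f x + K * lorentz x; pose G x := F x + K * atan x.
have cg : continuous g.
  move=> x; apply: cvgD; first exact: cf.
  by apply: cvgMl_tmp; exact: continuous_lorentz.
have mf : measurable_fun setT f by exact: continuous_measurable_fun.
have iK : L1 (fun x => K * lorentz x) by exact/L1Zl/L1_lorentz.
have fi : L1 f by exact: (L1_le _ iK).
have dG x : is_derive x 1 G (g x).
  by have dFx := dF x; exact: (derD dFx (derZ K (is_derive1_atan x))).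
have [||_ E] := @ge0_int_derive g G (K * pi) cg _ dG.
- by move=> x; rewrite /g -lerBlDr sub0r; have := fK x; rewrite ler_norml => /andP[].
- have FN0 g' : (forall x, `|g' x| <= K * lorentz x) -> g' x @[x --> +oo] --> (0:R).
    move=> g'K; apply: norm_cvg0.
    apply: (@squeeze_cvgr _ _ _ _ (cst 0) (fun x => K * lorentz x)).
    + by near=> x; rewrite /= normr_ge0 g'K.
    + exact: cvg_cst.
    + rewrite -[X in _ --> X](mulr0 K); apply: cvgMl_tmp; exact: cvgy_lorentz.
  rewrite (_ : (fun x => _) = (fun x => (F x - F (- x)) + (K * atan x + K * atan x))); last first.
    by apply/funext => x; rewrite /G atanN; ring.
  rewrite (_ : K * pi = (0 - 0) + (K * (pi / 2) + K * (pi / 2))); last by field.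
  apply: cvgD; first apply: cvgB.
  + exact: FN0.
  + by apply: FN0 => x; rewrite (le_trans (FK _))// /lorentz sqrrN.
  + by apply: cvgD; apply: cvgMl_tmp; exact: cvgy_atan.
move: E; rewrite /g intD// intZl ?lorentz_integral.2; last exact: L1_lorentz.
by lra.
Unshelve. all: end_near. Qed.

Lemma continuous_expN : continuous (fun x : R => expR (- `|x|)).
Proof.
move=> x; apply: (@continuous_comp _ _ _ (fun y : R => - `|y|) expR).
  by apply: cvgN; exact: norm_continuous.
exact: continuous_expR.
Qed.

(** The transform of the two-sided exponential.  Adding 1 to the cosine makes the
    integrand nonnegative; on the positive half-line it has the elementary
    antiderivative [F].  The case [x = 0] gives the integral of the exponential
    itself, which can then be subtracted. *)
Lemma integral_exp1cos x :
  L1 (fun y => expR (- `|y|) * (1 + cos (x * y))) /\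
  \int[mu]_y (expR (- `|y|) * (1 + cos (x * y))) = 2 + 2 * lorentz x.
Proof.
have cxy : continuous (fun y => cos (x * y)).
  move=> y; apply: (@continuous_comp _ _ _ (fun y => x * y) cos).
    exact: mulrl_continuous.
  exact: continuous_cos.
have cg : continuous (fun y => expR (- `|y|) * (1 + cos (x * y))).
  move=> y; apply: cvgM; first exact: continuous_expN.
  by apply: cvgD; [exact: cvg_cst|exact: cxy].
have g0 y : 0 <= expR (- `|y|) * (1 + cos (x * y)).
  by rewrite mulr_ge0 ?expR_ge0// addrC -lerBlDr sub0r cos_geN1.
apply: ge0_L1 => //; first exact: continuous_measurable_fun.
pose h y := expR (- y) * (1 + cos (x * y)).
pose F y := expR (- y) * (lorentz x * (x * sin (x * y) - cos (x * y)) - 1).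
have dF y : is_derive y 1 F (h y).
  rewrite /F /h.
  have dl : is_derive y 1 (fun y => x * y) x.
    by apply: der_eq (derZ x (der_id y)) _; rewrite mulr1.
  have de := der_comp (is_derive_expR (- y)) (derN (der_id y)).
  have ds := der_comp (is_derive_sin (x * y)) dl.
  have dc := der_comp (is_derive_cos (x * y)) dl.
  apply: der_eq (derM de (derB (derZ (lorentz x) (derB (derZ x ds) dc)) (der_cst 1 y))) _.
  have L : lorentz x * (1 + x ^+ 2) = 1.
    by rewrite mulVf// lt0r_neq0// ltr_pwDl// sqr_ge0.
  transitivity (expR (- y) * (1 + cos (x * y) * (lorentz x * (1 + x ^+ 2)))); first by ring.
  by rewrite L mulr1.
have F_cvg0 : F y @[y --> +oo] --> (0 : R).
  apply: norm_cvg0; pose c := lorentz x * (`|x| + 1) + 1.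
  apply: (@squeeze_cvgr _ _ _ _ (cst 0) (fun y => expR (- y) * c)).
  - near=> y; rewrite /= normr_ge0 /F normrM (ger0_norm (expR_ge0 _)).
    rewrite ler_wpM2l ?expR_ge0// (le_trans (ler_normB _ _))// normr1 lerD2r.
    rewrite normrM (ger0_norm (lorentz_ge0 x)) ler_wpM2l ?lorentz_ge0//.
    rewrite (le_trans (ler_normB _ _))// lerD ?cos_max//.
    by rewrite normrM ler_piMr// sin_max.
  - exact: cvg_cst.
  - by rewrite -[X in _ --> X](mul0r c); apply: cvgMr_tmp; exact: cvgr_expR.
rewrite (ge0_even_integral cg g0 _ _ dF F_cvg0).
- by rewrite /F !mulr0 oppr0 expR0 sin0 cos0; congr EFin; ring.
- by move=> y; rewrite normrN mulrN cosN.
- by move=> y y0; rewrite /h ger0_norm.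
Unshelve. all: end_near. Qed.

End FTC.

(** * Fourier inversion *)

Section Inversion.
Context {R : realType}.
Local Notation mu := (@lebesgue_measure R).
Implicit Types (f g a b : R -> R) (c e s t x y l : R).

Lemma continuous_cosM x : continuous (fun y => cos (x * y)).
Proof.
move=> y; apply: (@continuous_comp _ _ _ (fun y => x * y) cos).
  exact: mulrl_continuous.
exact: continuous_cos.
Qed.

Lemma continuous_sinM x : continuous (fun y => sin (x * y)).
Proof.
move=> y; apply: (@continuous_comp _ _ _ (fun y => x * y) sin).
  exact: mulrl_continuous.
exact: continuous_sin.
Qed.

Lemma L1_cosM x f : L1 f -> L1 (fun y => cos (x * y) * f y).
Proof.
apply: (@L1_bddM _ _ _ 1) => [|y]; last exact: cos_max.
by apply: continuous_measurable_fun; exact: continuous_cosM.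
Qed.

Lemma L1_sinM x f : L1 f -> L1 (fun y => sin (x * y) * f y).
Proof.
apply: (@L1_bddM _ _ _ 1) => [|y]; last exact: sin_max.
by apply: continuous_measurable_fun; exact: continuous_sinM.
Qed.

Lemma expN_integral : L1 (fun y : R => expR (- `|y|)) /\
  \int[mu]_y (expR (- `|y|)) = 2.
Proof.
have [i1 E1] := integral_exp1cos (0 : R).
have E y : expR (- `|y|) * (1 + cos (0 * y)) = 2 * expR (- `|y|).
  by rewrite mul0r cos0; ring.
have i2 : L1 (fun y : R => expR (- `|y|)).
  by apply: eq_L1 (L1Zl (2^-1) i1) => y; rewrite E mulKf.
split=> //; move: E1; rewrite (eq_int E) intZl// /lorentz expr0n /= addr0 invr1.
by move=> H; lra.
Qed.

Lemma L1_expNM e : e != 0 -> L1 (fun y => expR (- `|e * y|)).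
Proof.
move=> e0; apply: eq_L1 (L1_affine 0 e0 (expN_integral.1)) => y.
by rewrite addr0.
Qed.

Lemma int_expNcos e x : 0 < e ->
  \int[mu]_y (cos (x * y) * expR (- `|e * y|)) = 2 * (e^-1 * lorentz (x / e)).
Proof.
move=> e0; have eN0 : e != 0 by rewrite gt_eqF.
have iE := expN_integral.1.
have E : \int[mu]_y (cos (x / e * y) * expR (- `|y|)) = 2 * lorentz (x / e).
  have [_] := integral_exp1cos (x / e).
  under eq_Rintegral do rewrite mulrDr mulr1 [X in _ + X]mulrC.
  rewrite intD//; last exact: L1_cosM.
  by rewrite expN_integral.2; lra.
apply: (mulfI eN0); rewrite mulrCA mulVKf// -E.
rewrite [RHS](int_affine 0 eN0); last exact: L1_cosM.
rewrite (gtr0_norm e0); congr (_ * _); apply: eq_int => y.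
by rewrite addr0; congr (cos _ * _); field.
Qed.

Lemma int_expNsin e x : 0 < e ->
  \int[mu]_y (sin (x * y) * expR (- `|e * y|)) = 0.
Proof.
move=> e0; have eN0 : e != 0 by rewrite gt_eqF.
have i1 := L1_sinM x (L1_expNM eN0).
set I := LHS; have : I = - I.
  rewrite {1}/I (@int_affine _ (-1) 0)// normrN1 mul1r -intN//.
  by apply: eq_int => y; rewrite addr0 mulN1r !mulrN sinN mulNr normrN.
by move=> H; lra.
Qed.

Lemma int_fubini (F : R * R -> R) g1 g2 :
  measurable_fun [set: measurableTypeR R * measurableTypeR R] F ->
  L1 g1 -> L1 g2 -> (forall x y, `|F (x, y)| <= g1 x * g2 y) ->
  \int[mu]_x (\int[mu]_y F (x, y)) = \int[mu]_y (\int[mu]_x F (x, y)).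
Proof.
move=> mF i1 i2 Fg.
have mF1 x : measurable_fun setT (fun y => F (x, y)).
  exact: (measurableT_comp mF (pair1_measurable x)).
have mF2 y : measurable_fun setT (fun x => F (x, y)).
  exact: (measurableT_comp mF (pair2_measurable y)).
have iF1 x : L1 (fun y => F (x, y)).
  exact: (L1_le (mF1 x) (L1Zl (g1 x) i2)).
have iF2 y : L1 (fun x => F (x, y)).
  by apply: (L1_le (mF2 y) (L1Zl (g2 y) i1)) => x; rewrite mulrC.
have E1 x : (\int[mu]_y (F (x, y))%:E = (\int[mu]_y F (x, y))%:E)%E.
  by rewrite /Rintegral fineK//; apply: integrable_fin_num => //; exact: iF1.
have E2 y : (\int[mu]_x (F (x, y))%:E = (\int[mu]_x F (x, y))%:E)%E.
  by rewrite /Rintegral fineK//; apply: integrable_fin_num => //; exact: iF2.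
have mEF : measurable_fun [set: measurableTypeR R * measurableTypeR R] (EFin \o F).
  exact/measurable_EFinP.
pose c := \int[mu]_y `|g2 y|.
have Fc x : (\int[mu]_y `|(EFin \o F) (x, y)| <= (`|g1 x| * c)%:E)%E.
  have -> : (\int[mu]_y `|(EFin \o F) (x, y)| = (\int[mu]_y `|F (x, y)|)%:E)%E.
    rewrite /Rintegral fineK//; apply: integrable_fin_num => //.
    exact: (L1_norm (iF1 x)).
  rewrite lee_fin /c -intZl; last exact: L1_norm.
  apply: le_int; [exact: L1_norm|exact/L1Zl/L1_norm|] => y.
  by rewrite (le_trans (Fg x y))// -normrM ler_norm.
have iF : (mu \x mu)%E.-integrable setT (EFin \o F).
  apply/integrable12ltyP => //.
  have i3 : L1 (fun x => c * `|g1 x|) by exact/L1Zl/L1_norm.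
  apply: (@le_lt_trans _ _ (\int[mu]_x (c * `|g1 x|)%:E)%E); last first.
    exact: (integrable_lty _ i3).
  apply: ge0_le_integral => //.
  - by move=> x _; exact: integral_ge0.
  - apply: (@measurable_fun_fubini_tonelli_F _ _ _ _ _ mu (abse \o (EFin \o F))) => //=.
    exact: measurableT_comp.
  - by apply/measurable_EFinP; exact: L1_measurable i3.
  - by move=> x _; rewrite mulrC; exact: Fc.
have := Fubini iF; rewrite /=.
under eq_integral do rewrite E1.
under [in RHS]eq_integral do rewrite E2.
by rewrite /Rintegral => ->.
Qed.

(** The real part of the Fourier transform of [a + i b]; the imaginary part is
    [trigT b (- a)].  Working with such pairs keeps all integrals real. *)
Definition trigT a b x := \int[mu]_t (cos (x * t) * a t + sin (x * t) * b t).

Lemma L1_trigT a b x : L1 a -> L1 b ->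
  L1 (fun t => cos (x * t) * a t + sin (x * t) * b t).
Proof. by move=> ia ib; apply: L1D; [exact: L1_cosM|exact: L1_sinM]. Qed.

(** The damping factor makes the double integral absolutely convergent, so that
    Fubini's theorem applies; the inner integral is then a Poisson kernel, and
    the sine part vanishes by oddness. *)
Lemma trigT_regularized a b e t : L1 a -> L1 b -> 0 < e ->
  \int[mu]_y (expR (- `|e * y|) *
    (cos (t * y) * trigT a b y - sin (t * y) * trigT b (fun s => - a s) y)) =
  \int[mu]_s (a s * (2 * (e^-1 * lorentz ((t - s) / e)))).
Proof.
move=> ia ib e0; have eN0 : e != 0 by rewrite gt_eqF.
pose F (z : R * R) := expR (- `|e * z.1|) *
  (cos ((t - z.2) * z.1) * a z.2 - sin ((t - z.2) * z.1) * b z.2).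
have mF : measurable_fun [set: measurableTypeR R * measurableTypeR R] F.
  have m1 : measurable_fun [set: measurableTypeR R * measurableTypeR R]
      (fun z => (t - z.2) * z.1 : measurableTypeR R).
    apply: measurable_funM; last exact: measurable_fst.
    by apply: measurable_funB => //; exact: measurable_snd.
  have m2 h : measurable_fun setT h ->
      measurable_fun [set: measurableTypeR R * measurableTypeR R] (fun z => h z.2 : R).
    by move=> mh; exact: (measurableT_comp mh measurable_snd).
  have m3 h : measurable_fun setT h ->
      measurable_fun [set: measurableTypeR R * measurableTypeR R] (fun z => h z.1 : R).
    by move=> mh; exact: (measurableT_comp mh measurable_fst).
  have mc (h : R -> R) : continuous h -> measurable_fun setT h.
    exact: continuous_measurable_fun.
  apply: measurable_funM.
    by apply: (m3 (fun y => expR (- `|e * y|))); exact: L1_measurable (L1_expNM eN0).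
  apply: measurable_funB; apply: measurable_funM.
  - exact: (measurableT_comp (mc _ (@continuous_cos R)) m1).
  - by apply: m2; exact: L1_measurable ia.
  - exact: (measurableT_comp (mc _ (@continuous_sin R)) m1).
  - by apply: m2; exact: L1_measurable ib.
transitivity (\int[mu]_y (\int[mu]_s F (y, s))).
  apply: eq_int => y; have i1 := L1_trigT y ia ib.
  have i2 := L1_trigT y ib (L1N ia).
  rewrite /trigT -!intZl// -intB -?intZl; do ?apply: L1Zl => //; last first.
    by apply: L1B; exact: L1Zl.
  apply: eq_int => s; rewrite /F /= mulrBl cosB sinB !(mulrC y).
  by rewrite (mulrC s y); ring.
rewrite (@int_fubini F (fun y => expR (- `|e * y|)) (fun s => `|a s| + `|b s|))//.
- apply: eq_int => s; rewrite /F /=.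
  transitivity (\int[mu]_y (a s * (cos ((t - s) * y) * expR (- `|e * y|))
     - b s * (sin ((t - s) * y) * expR (- `|e * y|)))).
    by apply: eq_int => y; ring.
  have i1 := L1_expNM eN0.
  rewrite intB ?intZl ?int_expNcos ?int_expNsin ?mulr0 ?subr0//;
    do ?apply: L1Zl; solve [exact: L1_cosM|exact: L1_sinM].
- exact: L1_expNM.
- by apply: L1D; exact: L1_norm.
- move=> y s; rewrite /F /= normrM (ger0_norm (expR_ge0 _)).
  rewrite ler_wpM2l ?expR_ge0// (le_trans (ler_normB _ _))// !normrM.
  by rewrite lerD// ler_piMl// ?cos_max ?sin_max.
Qed.

End Inversion.

Section InversionTheorem.
Context {R : realType}.
Local Notation mu := (@lebesgue_measure R).
Implicit Types (f g a b : R -> R) (c e s t x y l : R).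

Lemma lorentz_scaled_le e x : 0 < e ->
  e^-1 * lorentz (x / e) = e / (e ^+ 2 + x ^+ 2).
Proof.
move=> e0; have e20 : 0 < e ^+ 2 by exact: exprn_gt0.
have x20 : 0 <= x ^+ 2 by exact: sqr_ge0.
by rewrite /lorentz; field; rewrite !lt0r_neq0//; nra.
Qed.

(** Poisson kernels form an approximate identity: near [t] continuity of [a] is
    used, and away from [t] the kernel is [O(e)], both absolutely and relatively
    to [lorentz]. *)
Lemma poisson_approx a t n : L1 a -> {for t, continuous a} -> 0 < n ->
  exists2 e0 : R, 0 < e0 & forall e, 0 < e -> e < e0 ->
  `|\int[mu]_s (a s * (2 * (e^-1 * lorentz ((t - s) / e)))) - 2 * pi * a t| <= n.
Proof.
move=> ia cat n0.
pose n' := n / (4 * pi).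
have pi0 : 0 < pi :> R by exact: pi_gt0.
have n'0 : 0 < n' by rewrite divr_gt0// mulr_gt0.
have /cvgrPdist_le/(_ _ n'0) := cat.
move=> [d /= d0 ad].
have d20 : 0 < d ^+ 2 by exact: exprn_gt0.
pose c := 2 / d ^+ 2 * \int[mu]_s `|a s| + `|a t| * (2 * (1 + (d ^+ 2)^-1)) * pi.
have c0 : 0 <= c.
  have J0 : 0 <= \int[mu]_s `|a s| by exact: Rintegral_ge0.
  have dV0 : 0 <= (d ^+ 2)^-1 by rewrite invr_ge0 ltW.
  have two0 : 0 <= 2 :> R by exact: ler0n.
  rewrite /c; apply: addr_ge0; first by apply: mulr_ge0 => //; exact: mulr_ge0.
  apply: mulr_ge0; last exact: ltW.
  by apply: mulr_ge0 => //; apply: mulr_ge0 => //; exact: addr_ge0.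
(* [n'] gives [n / 2] after integration, and the remaining terms add up to [e * c]. *)
exists (n / (2 * (c + 1))) => [|e e0 ee].
  by rewrite divr_gt0// mulr_gt0// ltr_pwDr.
have eN0 : e != 0 by rewrite gt_eqF.
pose P s := 2 * (e^-1 * lorentz ((t - s) / e)).
have P0 s : 0 <= P s.
  apply: mulr_ge0 => //; apply: mulr_ge0; last exact: lorentz_ge0.
  by rewrite invr_ge0 ltW.
have eVN0 : - e^-1 != 0 by rewrite oppr_eq0 invr_eq0.
have iP : L1 P.
  apply: L1Zl; apply: L1Zl; apply: eq_L1 (L1_affine (t / e) eVN0 L1_lorentz) => s.
  by congr lorentz; field.
have PE : \int[mu]_s P s = 2 * pi.
  have i1 : L1 (fun s => lorentz ((t - s) / e)).
    apply: eq_L1 (L1_affine (t / e) eVN0 L1_lorentz) => s.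
    by congr lorentz; field.
  rewrite intZl; last exact: L1Zl.
  rewrite intZl//; congr (_ * _); rewrite -lorentz_integral.2.
  rewrite [RHS](int_affine (t / e) eVN0); last exact: L1_lorentz.
  rewrite normrN (gtr0_norm (_ : 0 < e^-1)) ?invr_gt0//; congr (_ * _).
  by apply: eq_int => s; congr lorentz; field.
have mP := L1_measurable iP.
have bP s : `|P s| <= 2 / e.
  rewrite ger0_norm// /P mulrA ler_piMr ?lorentz_le1//.
  by apply: mulr_ge0 => //; rewrite invr_ge0 ltW.
have iaP : L1 (fun s => a s * P s).
  by apply: eq_L1 (L1_bddM mP bP ia) => s; rewrite mulrC.
rewrite -PE (mulrC _ (a t)) -intZl// -intB//; last exact: L1Zl.
pose D s := n' * P s + (2 * e / d ^+ 2 * `|a s| +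
  `|a t| * (2 * e * (1 + (d ^+ 2)^-1)) * lorentz (s - t)).
have iD1 : L1 (fun s => lorentz (s - t)).
  by apply: eq_L1 (L1_affine (- t) (oner_neq0 _) L1_lorentz) => s; rewrite mul1r.
have D1E : \int[mu]_s lorentz (s - t) = pi.
  rewrite -lorentz_integral.2 [RHS](@int_affine _ 1 (- t)) ?oner_eq0//; last first.
    exact: L1_lorentz.
  by rewrite normr1 mul1r; apply: eq_int => s; rewrite mul1r.
have iD2 : L1 (fun s => 2 * e / d ^+ 2 * `|a s| +
  `|a t| * (2 * e * (1 + (d ^+ 2)^-1)) * lorentz (s - t)).
  by apply: L1D; apply: L1Zl => //; exact: L1_norm.
have iD : L1 D by apply: L1D => //; exact: L1Zl.
have DE : \int[mu]_s D s <= n.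
  rewrite /D intD//; last exact: L1Zl.
  rewrite intD; [|exact/L1Zl/L1_norm|exact: L1Zl].
  rewrite (intZl n' iP) (intZl _ (L1_norm ia)) (intZl _ iD1) PE D1E; set J := \int[mu]_s `|a s|.
  apply: (@le_trans _ _ (n / 2 + e * c)).
    rewrite le_eqVlt; apply/orP; left; apply/eqP; rewrite /n' /c -/J.
    by move: (pi : R) pi0 => p p0; field; rewrite !gt_eqF.
  have : e * (2 * (c + 1)) < n by rewrite -ltr_pdivlMr// mulr_gt0// ltr_pwDr.
  by nra.
apply: le_trans DE; apply: norm_int_le => //.
  apply: measurable_funB; first exact: L1_measurable iaP.
  by apply: measurable_funM.
move=> s; rewrite -mulrBl normrM (ger0_norm (P0 s)) /D.
have r1 : 0 <= 2 * e / d ^+ 2 * `|a s|.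
  by rewrite mulr_ge0// divr_ge0 ?ltW// mulr_gt0.
have r2 : 0 <= `|a t| * (2 * e * (1 + (d ^+ 2)^-1)) * lorentz (s - t).
  rewrite mulr_ge0 ?lorentz_ge0// mulr_ge0// mulr_ge0 ?addr_ge0 ?invr_ge0 ?ltW//.
  by rewrite mulr_gt0.
have [ts|dts] := ltP `|t - s| d.
  rewrite -[leLHS]addr0 lerD ?addr_ge0// ler_wpM2r// distrC; exact: ad.
have q1 : 0 <= n' * P s by apply: mulr_ge0 => //; exact: ltW.
rewrite -[leLHS]add0r; apply: lerD => //.
apply: (@le_trans _ _ (`|a s| * P s + `|a t| * P s)).
  by rewrite -mulrDl; apply: ler_wpM2r => //; exact: ler_normB.
have dx : d ^+ 2 <= (t - s) ^+ 2.
  by rewrite -[leRHS]real_normK ?num_real// ler_pXn2r// ?nnegrE// ltW.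
have E0 : 0 < e ^+ 2 by exact: exprn_gt0.
have PE2 : P s = 2 * e * (e ^+ 2 + (t - s) ^+ 2)^-1.
  by rewrite /P lorentz_scaled_le// mulrA.
have e2_0 : 0 <= 2 * e by rewrite mulr_ge0// ltW.
have P1 : P s <= 2 * e / d ^+ 2.
  rewrite PE2; apply: ler_wpM2l => //.
  rewrite lef_pV2 ?posrE//; move: dx d20 E0;
    by move: (d ^+ 2) (e ^+ 2) ((t - s) ^+ 2) => u v w; clear; lra.
have P2 : P s <= 2 * e * (1 + (d ^+ 2)^-1) * lorentz (s - t).
  rewrite PE2 -[leRHS]mulrA; apply: ler_wpM2l => //.
  rewrite /lorentz -[(s - t) ^+ 2]sqrrN opprB; move: dx d20 E0 => /=.
  move: (d ^+ 2) (e ^+ 2) ((t - s) ^+ 2) => u v w uw u0 v0.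
  clear - uw u0 v0.
  rewrite ler_pdivlMr; last by nra.
  rewrite mulrC ler_pdivrMr; last by nra.
  have wu : 1 <= w * u^-1 by rewrite ler_pdivlMr// mul1r.
  have vu : 0 <= v * u^-1 by rewrite divr_ge0 ?ltW.
  by nra.
apply: lerD; first by rewrite mulrC; apply: ler_wpM2r.
by rewrite -[leRHS]mulrA; apply: ler_wpM2l.
Qed.

(** Letting the regularization [e] tend to 0 in [trigT_regularized]: the left
    side converges by domination, the right side by [poisson_approx]. *)
Theorem fourier_inversion a b t : L1 a -> L1 b -> {for t, continuous a} ->
  L1 (trigT a b) -> L1 (trigT b (fun s => - a s)) ->
  trigT (trigT a b) (fun y => - trigT b (fun s => - a s) y) t = 2 * pi * a t.
Proof.
move=> ia ib cat; set A := trigT a b; set B := trigT b _ => iA iB.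
pose f e y := expR (- `|e * y|) * (cos (t * y) * A y - sin (t * y) * B y).
have iAB : L1 (fun y => cos (t * y) * A y - sin (t * y) * B y).
  by apply: L1B; [exact: L1_cosM|exact: L1_sinM].
have me e : measurable_fun setT (fun y => expR (- `|e * y|)).
  apply: continuous_measurable_fun => y.
  apply: (@continuous_comp _ _ _ (fun y => e * y) (fun y => expR (- `|y|))).
    exact: mulrl_continuous.
  exact: continuous_expN.
have e1 e y : `|expR (- `|e * y|)| <= 1.
  by rewrite ger0_norm ?expR_ge0// -expR0 ler_expR oppr_le0.
have i_f e : L1 (f e) by exact: (L1_bddM (me e) (e1 e) iAB).
have cI : {for 0, continuous (fun e => \int[mu]_y f e y)}.
  apply: (@continuity_under_integral R _ _ mu f setT measurableT (-1) 1 _ _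
    (fun y => `|cos (t * y) * A y - sin (t * y) * B y|)).
  - by move=> e _; exact: i_f.
  - apply/aeW => y _ e _; apply: cvgM; last exact: cvg_cst.
    apply: (@continuous_comp _ _ _ (fun e => e * y) (fun y => expR (- `|y|))).
      exact: mulrr_continuous.
    exact: continuous_expN.
  - exact: L1_norm.
  - by move=> e _; apply/aeW => y _; rewrite /f normrM ler_piMl.
  - by rewrite inE/= in_itv/= ltrN10 ltr01.
have -> : trigT A (fun y => - B y) t = \int[mu]_y f 0 y.
  by apply: eq_int => y; rewrite /f mul0r normr0 oppr0 expR0 mul1r mulrN.
set J := \int[mu]_y f 0 y.
apply/eqP; rewrite -subr_eq0 -normr_eq0; apply/negPn/negP => neq0.
pose n := `|J - 2 * pi * a t| / 3.
have n0 : 0 < n by rewrite divr_gt0// lt_neqAle eq_sym neq0 normr_ge0.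
have [e0 e00 He] := poisson_approx ia cat n0.
have /cvgrPdist_le/(_ _ n0)[d /= d0 Hd] := cI.
pose e := Num.min e0 d / 2.
have m0 : 0 < Num.min e0 d by rewrite lt_min e00.
have e_gt0 : 0 < e by rewrite divr_gt0.
have e_lt : e < Num.min e0 d by rewrite /e; lra.
have H1 : `|J - \int[mu]_y f e y| <= n.
  apply: Hd; rewrite /= sub0r normrN gtr0_norm//.
  by rewrite (lt_le_trans e_lt)// ge_min lexx orbT.
have H2 : `|\int[mu]_y f e y - 2 * pi * a t| <= n.
  rewrite /f (@trigT_regularized _ a b e t)//; apply: He => //.
  by rewrite (lt_le_trans e_lt)// ge_min lexx.
have := ler_normD (J - \int[mu]_y f e y) (\int[mu]_y f e y - 2 * pi * a t).
rewrite addrA subrK => H3.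
move: n0 H1 H2 H3; rewrite /n; move: `|J - 2 * pi * a t| => z.
move: `|J - _| `|_ - 2 * pi * a t| => v w; clear; lra.
Qed.

End InversionTheorem.

(** * Transforms of twice differentiable functions *)

Section TransformC2.
Context {R : realType}.
Local Notation mu := (@lebesgue_measure R).
Implicit Types (f g a b m n : R -> R) (c e s t x y K al : R).

Definition C2_le K m := exists m1 m2 : R -> R,
  [/\ forall x, is_derive x 1 m (m1 x), forall x, is_derive x 1 m1 (m2 x),
      continuous m2 &
      forall x, [/\ `|m x| <= K * lorentz x, `|m1 x| <= K * lorentz x
                  & `|m2 x| <= K * lorentz x]].

Lemma C2_le_continuous K m : C2_le K m -> continuous m.
Proof. by move=> [m1 [m2 [d1 _ _ _]]]; exact: der_continuous d1. Qed.

Lemma C2_le_ge0 K m : C2_le K m -> 0 <= K.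
Proof.
move=> [m1 [m2 [_ _ _ /(_ 0)[+ _ _]]]] => /(le_trans (normr_ge0 _)).
by rewrite pmulr_lge0// lorentz_gt0.
Qed.

Lemma C2_leN K m : C2_le K m -> C2_le K (fun x => - m x).
Proof.
move=> [m1 [m2 [d1 d2 c2 H]]]; exists (fun x => - m1 x), (fun x => - m2 x).
split=> [x|x|x|x]; [exact: derN|exact: derN|exact: cvgN (c2 x)|].
by rewrite !normrN.
Qed.

Lemma C2_le_L1 K m : C2_le K m -> L1 m.
Proof.
move=> mK; have [m1 [m2 [_ _ _ H]]] := mK.
apply: (L1_le _ (L1Zl K L1_lorentz)) => [|x]; last by have [] := H x.
by apply: continuous_measurable_fun; exact: C2_le_continuous mK.
Qed.

Lemma trigT_le f g a b x : measurable_fun setT a -> measurable_fun setT b ->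
  L1 f -> L1 g -> (forall t, `|a t| <= f t) -> (forall t, `|b t| <= g t) ->
  `|trigT a b x| <= \int[mu]_t f t + \int[mu]_t g t.
Proof.
move=> ma mb fi gi af bg; rewrite -intD//; apply: norm_int_le.
- have ia := L1_le ma fi af; have ib := L1_le mb gi bg.
  exact: L1_measurable (L1_trigT x ia ib).
- exact: L1D.
- move=> t; rewrite (le_trans (ler_normD _ _))// !normrM lerD//.
    by rewrite (le_trans _ (af t))// ler_piMl// cos_max.
  by rewrite (le_trans _ (bg t))// ler_piMl// sin_max.
Qed.

(** Two integrations by parts, in the form of a single exact derivative: up to
    the factor [s ^+ 2] the transform of [(m, n)] is that of [(m'', n'')]. *)
Lemma trigT_decay K m n s : C2_le K m -> C2_le K n ->
  `|trigT m n s| <= 4 * K * pi * lorentz s.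
Proof.
move=> mK nK; have [m1 [m2 [dm1 dm2 cm2 mb]]] := mK.
have [n1 [n2 [dn1 dn2 cn2 nb]]] := nK.
have K0 := C2_le_ge0 mK.
have qi : L1 (fun t => K * lorentz t) by exact/L1Zl/L1_lorentz.
have qE : \int[mu]_t (K * lorentz t) = K * pi.
  by rewrite intZl ?lorentz_integral.2//; exact: L1_lorentz.
have cm := C2_le_continuous mK; have cn := C2_le_continuous nK.
have mm2 : measurable_fun setT m2 by exact: continuous_measurable_fun.
have mn2 : measurable_fun setT n2 by exact: continuous_measurable_fun.
have im := C2_le_L1 mK; have i_n := C2_le_L1 nK.
have im2 : L1 m2 by apply: (L1_le mm2 qi) => x; have [] := mb x.
have in2 : L1 n2 by apply: (L1_le mn2 qi) => x; have [] := nb x.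
have T0 : `|trigT m n s| <= 2 * K * pi.
  rewrite (le_trans (@trigT_le _ _ _ _ _ _ _ qi qi _ _))//.
  - exact: L1_measurable im.
  - exact: L1_measurable i_n.
  - by move=> x; have [] := mb x.
  - by move=> x; have [] := nb x.
  - by rewrite qE; lra.
have T2 : `|trigT m2 n2 s| <= 2 * K * pi.
  rewrite (le_trans (@trigT_le _ _ _ _ _ _ _ qi qi _ _))//.
  - by move=> x; have [] := mb x.
  - by move=> x; have [] := nb x.
  - by rewrite qE; lra.
have E : s ^+ 2 * trigT m n s = - trigT m2 n2 s.
  apply/eqP; rewrite -subr_eq0 opprK; apply/eqP.
  rewrite /trigT -intZl; last exact: L1_trigT.
  rewrite -intD; [|exact/L1Zl/L1_trigT|exact: L1_trigT].
  pose F y := (s * (sin (s * y) * m y) + cos (s * y) * m1 y) +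
              (sin (s * y) * n1 y - s * (cos (s * y) * n y)).
  have w0 y : 0 <= K * lorentz y by rewrite mulr_ge0 ?lorentz_ge0.
  have cc := @continuous_cosM _ s; have cs := @continuous_sinM _ s.
  have cs1 y : `|cos (s * y)| <= 1 by exact: cos_max.
  have sn1 y : `|sin (s * y)| <= 1 by exact: sin_max.
  have leM (u v w : R) : `|u| <= 1 -> `|v| <= w -> `|u * v| <= w.
    by move=> u1 vw; rewrite normrM (le_trans _ vw)// ler_piMl.
  apply: (@int_derive0 _ _ F ((2 * s ^+ 2 + 2 * `|s| + 2) * K)).
  - move=> y; apply: cvgD; [apply: cvgMl_tmp|]; apply: cvgD; apply: cvgM;
      by [exact: cc|exact: cs|exact: cm|exact: cn|exact: cm2|exact: cn2].
  - move=> y.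
    have dl : is_derive y 1 (fun y => s * y) s.
      by apply: der_eq (derZ s (der_id y)) _; rewrite mulr1.
    have ds := der_comp (is_derive_sin (s * y)) dl.
    have dc := der_comp (is_derive_cos (s * y)) dl.
    apply: der_eq (derD (derD (derZ s (derM ds (dm1 y))) (derM dc (dm2 y)))
      (derB (derM ds (dn2 y)) (derZ s (derM dc (dn1 y))))) _.
    by ring.
  - move=> y; have [m_0 m_1 m_2] := mb y; have [n_0 n_1 n_2] := nb y.
    apply: (@le_trans _ _ (s ^+ 2 * (2 * (K * lorentz y)) + 2 * (K * lorentz y))).
      rewrite (le_trans (ler_normD _ _))// normrM (ger0_norm (sqr_ge0 s)).
      rewrite lerD// ?ler_wpM2l ?sqr_ge0// (le_trans (ler_normD _ _))//.
        by rewrite mulrDl mul1r lerD// leM.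
      by rewrite mulrDl mul1r lerD// leM.
    rewrite -[leRHS]mulrA; have := mulr_ge0 (normr_ge0 s) (w0 y); lra.
  - move=> y; have [m_0 m_1 m_2] := mb y; have [n_0 n_1 n_2] := nb y.
    apply: (@le_trans _ _ ((`|s| * (K * lorentz y) + K * lorentz y) +
      (K * lorentz y + `|s| * (K * lorentz y)))).
      rewrite (le_trans (ler_normD _ _))// lerD//.
        rewrite (le_trans (ler_normD _ _))// lerD//; last exact: leM.
        by rewrite normrM ler_wpM2l// leM.
      rewrite (le_trans (ler_normB _ _))// lerD//; first exact: leM.
      by rewrite normrM ler_wpM2l// leM.
    rewrite -[leRHS]mulrA; have := mulr_ge0 (sqr_ge0 s) (w0 y); lra.
rewrite /lorentz ler_pdivlMr; last by rewrite ltr_pwDl// sqr_ge0.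
have -> : `|trigT m n s| * (1 + s ^+ 2) = `|trigT m n s| + `|s ^+ 2 * trigT m n s|.
  by rewrite normrM (ger0_norm (sqr_ge0 s)); ring.
by rewrite E normrN; move: T0 T2; lra.
Qed.

Lemma norm_diff_le_deriv f (df : R -> R) K (u v : R) :
  (forall x, is_derive x 1 f (df x)) ->
  (forall x, `|x| <= Num.max `|u| `|v| -> `|df x| <= K) -> `|f v - f u| <= K * `|v - u|.
Proof.
move=> dF dK; wlog uv : u v dK / u <= v.
  move=> H; have [uv|/ltW vu] := leP u v; first exact: H.
  by rewrite distrC (distrC v); apply: H => // x; rewrite maxC; exact: dK.
have cf : {within `[u, v], continuous f}.
  by apply: continuous_subspaceT; exact: der_continuous dF.
have [c] := @MVT_segment _ f df u v uv (fun x _ => dF x) cf.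
rewrite in_itv/= => /andP[uc cv] ->; rewrite normrM ler_wpM2r//; apply: dK.
have := ler_norm v; have := ler_norm (- u); rewrite normrN ler_norml.
have : `|u| <= Num.max `|u| `|v| by rewrite le_max lexx.
have : `|v| <= Num.max `|u| `|v| by rewrite le_max lexx orbT.
by move=> *; apply/andP; split; lra.
Qed.

(** The bounds [`|x - y|] and 2 on the increment interpolate to any exponent
    between 0 and 1. *)
Lemma trig_holder (u : R -> R) al x y : 0 <= al <= 1 ->
  `|u x - u y| <= `|x - y| -> `|u x - u y| <= 2 -> `|u x - u y| <= 2 * `|x - y| `^ al.
Proof.
move=> /andP[al0 al1] l1 l2; have [h|h] := leP `|x - y| 1.
  have [->|z] := eqVneq x y; first by rewrite subrr normr0 mulr_ge0// powR_ge0.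
  rewrite (le_trans l1)// (@le_trans _ _ (`|x - y| `^ al))//.
    by rewrite ger1_powR// h normr_gt0 subr_eq0 z.
  by rewrite ler_peMl ?powR_ge0// ler1n.
rewrite (le_trans l2)// ler_peMr// -(powRr0 `|x - y|) ler_powR// ltW//.
Qed.

Lemma cos_holder al x y : 0 <= al <= 1 -> `|cos x - cos y| <= 2 * `|x - y| `^ al.
Proof.
move=> al01; apply: trig_holder => //.
  rewrite -[leRHS]mul1r; apply: (@norm_diff_le_deriv _ (fun x => - sin x)) => z _.
  by rewrite normrN sin_max.
by rewrite (le_trans (ler_normB _ _))// -[leRHS]/(1 + 1) lerD// cos_max.
Qed.

Lemma sin_holder al x y : 0 <= al <= 1 -> `|sin x - sin y| <= 2 * `|x - y| `^ al.
Proof.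
move=> al01; apply: trig_holder => //.
  rewrite -[leRHS]mul1r; apply: (@norm_diff_le_deriv _ cos) => z _.
  exact: cos_max.
by rewrite (le_trans (ler_normB _ _))// -[leRHS]/(1 + 1) lerD// sin_max.
Qed.

(** Moments of order [al] of the functions give Hoelder continuity of order [al]
    of the transform. *)
Lemma trigT_holder K al m n s t : 0 <= al <= 1 -> L1 m -> L1 n ->
  (forall x, `|x| `^ al * `|m x| <= K * lorentz x) ->
  (forall x, `|x| `^ al * `|n x| <= K * lorentz x) ->
  `|trigT m n s - trigT m n t| <= 4 * K * pi * `|s - t| `^ al.
Proof.
move=> al01 im i_n mK nK; rewrite /trigT -intB; try exact: L1_trigT.
pose c := 2 * `|s - t| `^ al.
have iq : L1 (fun y => c * (2 * K) * lorentz y) by exact/L1Zl/L1_lorentz.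
have -> : 4 * K * pi * `|s - t| `^ al = \int[mu]_y (c * (2 * K) * lorentz y).
  by rewrite intZl ?lorentz_integral.2; [rewrite /c; ring|exact: L1_lorentz].
apply: norm_int_le => //.
  by apply: measurable_funB; apply: L1_measurable; exact: L1_trigT.
move=> y.
have -> : cos (s * y) * m y + sin (s * y) * n y - (cos (t * y) * m y + sin (t * y) * n y)
  = (cos (s * y) - cos (t * y)) * m y + (sin (s * y) - sin (t * y)) * n y by ring.
have E : `|s * y - t * y| `^ al = `|s - t| `^ al * `|y| `^ al.
  by rewrite -mulrBl normrM powRM.
have c0 : 0 <= c by rewrite mulr_ge0// powR_ge0.
rewrite (le_trans (ler_normD _ _))//.
apply: (@le_trans _ _ (c * (K * lorentz y) + c * (K * lorentz y))); last by lra.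
apply: lerD; rewrite normrM.
  apply: (@le_trans _ _ (c * `|y| `^ al * `|m y|)).
    by rewrite ler_wpM2r// /c -mulrA -E cos_holder.
  by rewrite -mulrA ler_wpM2l.
apply: (@le_trans _ _ (c * `|y| `^ al * `|n y|)).
  by rewrite ler_wpM2r// /c -mulrA -E sin_holder.
by rewrite -mulrA ler_wpM2l.
Qed.

End TransformC2.

(** * The complex Fourier transform *)

Section ComplexFourier.
Context {R : realType}.
Local Notation mu := (@lebesgue_measure R).
Local Notation Re := (@complex.Re R).
Local Notation Im := (@complex.Im R).
Implicit Types (a b : R -> R) (f g : R -> R[i]) (t x y c : R) (z w : R[i]).

Lemma complexP z w : Re z = Re w -> Im z = Im w -> z = w.
Proof. by case: z w => [? ?] [? ?] /= -> ->. Qed.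

Lemma normcE_sqr z : normc z ^+ 2 = Re z ^+ 2 + Im z ^+ 2.
Proof. by case: z => u v /=; rewrite sqr_sqrtr// addr_ge0 ?sqr_ge0. Qed.

Lemma normc_ge0 z : 0 <= normc z.
Proof. by case: z => u v /=; rewrite sqrtr_ge0. Qed.

Lemma Re_le_normc z : `|Re z| <= normc z.
Proof.
by rewrite -(@ler_pXn2r _ 2)// ?nnegrE ?normc_ge0// normcE_sqr real_normK ?num_real// lerDl sqr_ge0.
Qed.

Lemma Im_le_normc z : `|Im z| <= normc z.
Proof.
by rewrite -(@ler_pXn2r _ 2)// ?nnegrE ?normc_ge0// normcE_sqr real_normK ?num_real// lerDr sqr_ge0.
Qed.

Lemma normc_le z : normc z <= `|Re z| + `|Im z|.
Proof.
rewrite -(@ler_pXn2r _ 2)// ?nnegrE ?normc_ge0 ?addr_ge0// normcE_sqr.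
rewrite sqrrD !real_normK ?num_real// lerD2r lerDl.
by rewrite mulrn_wge0// mulr_ge0.
Qed.

Lemma normc_real c : normc c%:C = `|c|.
Proof. by rewrite /= expr0n /= addr0 sqrtr_sqr. Qed.

Lemma ReZ c z : Re (c%:C * z) = c * Re z.
Proof. by case: z => u v /=; rewrite mul0r subr0. Qed.

Lemma ImZ c z : Im (c%:C * z) = c * Im z.
Proof. by case: z => u v /=; rewrite mul0r addr0. Qed.

Lemma fourierE f x : fourier f x =
  trigT (Re \o f) (Im \o f) x +i* trigT (Im \o f) (fun t => - Re (f t)) x.
Proof.
rewrite /fourier /cintegral /trigT; congr (_ +i* _); apply: eq_int => t;
  by rewrite /=; case: (f t) => u v /=; rewrite cosN sinN; ring.
Qed.

Lemma fourier0 f : fourier f 0 = cintegral f.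
Proof.
rewrite fourierE /trigT /cintegral; congr (_ +i* _); apply: eq_int => t;
  by rewrite mul0r cos0 sin0 mul1r mul0r addr0.
Qed.

Lemma classC0 f : classC 0 f <-> continuous (Re \o f) /\ continuous (Im \o f).
Proof.
split=> [H|[cr ci] u [->|->]]; last 2 first.
- by split.
- by split.
by have [_ cr] := H _ (or_introl erefl); have [_ ci] := H _ (or_intror erefl).
Qed.

Lemma trigT0 x : trigT (fun=> 0) (fun=> 0) x = 0 :> R.
Proof. by rewrite /trigT -[RHS]int0; apply: eq_int => t; rewrite !mulr0 addr0. Qed.

Lemma trigTB a a' b b' x : L1 a -> L1 a' -> L1 b -> L1 b' ->
  trigT (fun t => a t - a' t) (fun t => b t - b' t) x = trigT a b x - trigT a' b' x.
Proof.
move=> ia ia' ib ib'; rewrite /trigT -intB; try exact: L1_trigT.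
by apply: eq_int => t; ring.
Qed.

Lemma trigTZ c a b x : L1 a -> L1 b ->
  trigT (fun t => c * a t) (fun t => c * b t) x = c * trigT a b x.
Proof.
move=> ia ib; rewrite /trigT -intZl; last exact: L1_trigT.
by apply: eq_int => t; ring.
Qed.

Lemma trigTN a b x : L1 a -> L1 b ->
  trigT (fun t => - a t) (fun t => - b t) x = - trigT a b x.
Proof.
move=> ia ib; rewrite /trigT -intN; last exact: L1_trigT.
by apply: eq_int => t; ring.
Qed.

Lemma trigT_continuous a b : L1 a -> L1 b -> continuous (trigT a b).
Proof.
move=> ia ib x.
apply: (@continuity_under_integral R _ _ mu
  (fun x t => cos (x * t) * a t + sin (x * t) * b t) setT measurableT (x - 1) (x + 1)
  _ _ (fun t => `|a t| + `|b t|)).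
- by move=> y _; exact: L1_trigT.
- apply/aeW => t _ y _; apply: cvgD; apply: cvgMr_tmp.
    apply: (@continuous_comp _ _ _ (fun y => y * t) cos).
      exact: mulrr_continuous.
    exact: continuous_cos.
  apply: (@continuous_comp _ _ _ (fun y => y * t) sin).
    exact: mulrr_continuous.
  exact: continuous_sin.
- by apply: L1D; exact: L1_norm.
- move=> y _; apply/aeW => t _; rewrite (le_trans (ler_normD _ _))// !normrM.
  by rewrite lerD// ler_piMl// ?cos_max ?sin_max.
- by rewrite inE/= in_itv/= ltrBlDr ltrDl ltr01.
Qed.

(** A vanishing transform is integrable, so inversion applies to it. *)
Lemma trigT_inj a b : L1 a -> L1 b -> continuous a ->
  (forall x, trigT a b x = 0) -> (forall x, trigT b (fun t => - a t) x = 0) ->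
  forall t, a t = 0.
Proof.
move=> ia ib ca A0 B0 t.
have z : L1 (fun=> 0 : R) by exact: integrable0.
have EA : trigT a b = fun=> 0 by apply/funext.
have EB : trigT b (fun t => - a t) = fun=> 0 by apply/funext.
have := @fourier_inversion _ a b t ia ib (ca t).
rewrite EA EB => /(_ z z).
rewrite (_ : (fun y : R => - 0) = fun=> 0); last by apply/funext => y; rewrite oppr0.
rewrite trigT0 => /esym/eqP; rewrite mulf_eq0 => /orP[|/eqP//].
by rewrite gt_eqF// mulr_gt0// pi_gt0.
Qed.

Lemma fourier_inj f g : classC 0 f -> classC 0 g -> cintegrable f -> cintegrable g ->
  fourier f =1 fourier g -> f =1 g.
Proof.
move=> /classC0[cfr cfi] /classC0[cgr cgi] [ifr ifi] [igr igi] fg t.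
have E1 x : trigT (fun t => Re (f t) - Re (g t)) (fun t => Im (f t) - Im (g t)) x = 0.
  by rewrite trigTB//; have := fg x; rewrite !fourierE => -[-> _]; rewrite subrr.
have E2 x : trigT (fun t => Im (f t) - Im (g t)) (fun t => - (Re (f t) - Re (g t))) x = 0.
  have := fg x; rewrite !fourierE => -[_ /eqP]; rewrite -subr_eq0 => /eqP <-.
  rewrite -trigTB//; try exact: L1N.
  by congr trigT; apply/funext => s; ring.
have ir : L1 (fun t => Re (f t) - Re (g t)) by exact: L1B.
have ii : L1 (fun t => Im (f t) - Im (g t)) by exact: L1B.
have cr : continuous (fun t => Re (f t) - Re (g t)).
  by move=> s; apply: cvgB; [exact: cfr|exact: cgr].
have ci : continuous (fun t => Im (f t) - Im (g t)).
  by move=> s; apply: cvgB; [exact: cfi|exact: cgi].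
apply: complexP; apply/eqP; rewrite -subr_eq0; apply/eqP.
  exact: (trigT_inj ir ii cr E1 E2).
apply: (trigT_inj ii (L1N ir) ci E2) => x.
by rewrite trigTN// E1 oppr0.
Qed.

(** By injectivity the chosen preimage is the only one. *)
Lemma inv_fourier_eq f (g : R -> R[i]) : classC 0 f -> cintegrable f ->
  (forall x, fourier f x = g x) -> inv_fourier g = f.
Proof.
move=> cf fi fg; rewrite /inv_fourier; case: xgetP => [h _ [ch ih hg]|/(_ f)[]//].
by apply/funext/fourier_inj => // x; rewrite hg fg.
Qed.

Lemma trigT_affine a b al k x : L1 a -> L1 b -> 0 < al ->
  trigT (fun t => a (al * t - k)) (fun t => b (al * t - k)) x =
  al^-1 * (cos (k * (x / al)) * trigT a b (x / al) +
           sin (k * (x / al)) * trigT b (fun t => - a t) (x / al)).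
Proof.
move=> ia ib al0; have alN0 : al != 0 by rewrite gt_eqF.
set y := x / al; set th := k * y.
have i1 := L1_trigT y ia ib.
have i2 := L1_trigT y ib (L1N ia).
rewrite /trigT -!intZl// -intD; [|exact: L1Zl|exact: L1Zl].
rewrite [in RHS](int_affine (- k) alN0); last by apply: L1D; exact: L1Zl.
rewrite (gtr0_norm al0) mulKf//; apply: eq_int => t.
have -> : x * t = y * (al * t - k) + th.
  by rewrite /th /y; field.
by rewrite cosD sinD; ring.
Qed.

Lemma dyadicE f j (k : int) t :
  Re (dyadic f j k t) = 2 `^ (j%:R / 2) * Re (f (2 ^+ j * t - k%:~R)) /\
  Im (dyadic f j k t) = 2 `^ (j%:R / 2) * Im (f (2 ^+ j * t - k%:~R)).
Proof. by rewrite /dyadic ReZ ImZ. Qed.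

Lemma cintegrable_dyadic f j k : cintegrable f -> cintegrable (dyadic f j k).
Proof.
move=> [ir ii]; have al0 : 2 ^+ j != 0 :> R by rewrite expf_eq0 pnatr_eq0 andbF.
split.
  apply: eq_L1 (L1Zl (2 `^ (j%:R / 2)) (L1_affine (- k%:~R) al0 ir)) => t.
  by rewrite /= (dyadicE f j k t).1.
apply: eq_L1 (L1Zl (2 `^ (j%:R / 2)) (L1_affine (- k%:~R) al0 ii)) => t.
by rewrite /= (dyadicE f j k t).2.
Qed.

Lemma fourier_dyadic f j k x : cintegrable f ->
  fourier (dyadic f j k) x = (2 `^ (j%:R / 2) / 2 ^+ j)%:C *
    expi (- (k%:~R * (x / 2 ^+ j))) * fourier f (x / 2 ^+ j).
Proof.
move=> [ir ii]; have al0 : 0 < 2 ^+ j :> R by rewrite exprn_gt0.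
have alN0 : 2 ^+ j != 0 :> R by rewrite gt_eqF.
set c : R := 2 `^ (j%:R / 2).
rewrite !fourierE.
have -> : Re \o dyadic f j k = fun t => c * (Re \o f) (2 ^+ j * t - k%:~R).
  by apply/funext => t; rewrite /= (dyadicE f j k t).1.
have -> : Im \o dyadic f j k = fun t => c * (Im \o f) (2 ^+ j * t - k%:~R).
  by apply/funext => t; rewrite /= (dyadicE f j k t).2.
pose n s := - Re (f s).
have iN : L1 n by exact: L1N.
have -> : (fun t => - Re (dyadic f j k t)) = fun t => c * n (2 ^+ j * t - k%:~R).
  by apply/funext => t; rewrite (dyadicE f j k t).1 -mulrN.
rewrite !trigTZ; [|exact: L1_affine..].
rewrite (@trigT_affine (Re \o f) (Im \o f))// (@trigT_affine (Im \o f) n)//.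
rewrite (@trigTN (Re \o f) (Im \o f))//; set y := x / 2 ^+ j; set th := k%:~R * y.
by rewrite /expi cosN sinN; apply: complexP => /=; ring.
Qed.

Lemma inverse_trigT a b : L1 a -> L1 b -> continuous a ->
  L1 (trigT a (fun t => - b t)) -> L1 (trigT b a) ->
  forall x, trigT (fun s => (2 * pi)^-1 * trigT a (fun t => - b t) s)
                  (fun s => (2 * pi)^-1 * trigT b a s) x = a x.
Proof.
move=> ia ib ca iA iB x.
have ibN : L1 (fun t => - b t) by exact: L1N.
have EB : trigT (fun t => - b t) (fun t => - a t) = fun y => - trigT b a y.
  by apply/funext => y; rewrite trigTN.
have := @fourier_inversion _ a (fun t => - b t) x ia ibN (ca x) iA.
rewrite EB => /(_ (L1N iB)).
rewrite (_ : (fun y => - - trigT b a y) = trigT b a); last first.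
  by apply/funext => y; rewrite opprK.
move=> E; rewrite trigTZ// E mulKf// mulf_neq0 ?pnatr_eq0//.
by rewrite gt_eqF// pi_gt0.
Qed.

(** Two derivatives give the transform enough decay to be integrable, and the
    inversion theorem makes it a preimage of [M] under the Fourier transform. *)
Lemma inverse_fourier_C2 K al (M : R -> R[i]) : 0 < al <= 1 ->
  C2_le K (Re \o M) -> C2_le K (Im \o M) ->
  (forall x, `|x| `^ al * normc (M x) <= K * lorentz x) ->
  exists G : R -> R[i], [/\ classC 0 G, fourier G =1 M,
    forall t, normc (G t) <= 4 * K * lorentz t &
    forall s t, normc (G s - G t) <= 4 * K * `|s - t| `^ al].
Proof.
move=> /andP[al0 al1] rK iK MK; have al01 : 0 <= al <= 1 by rewrite ltW.
set a := Re \o M in rK *; set b := Im \o M in iK *.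
have pi0 : 0 < pi :> R by exact: pi_gt0.
have K0 := C2_le_ge0 rK.
have [ia ib] := (C2_le_L1 rK, C2_le_L1 iK).
have ibN := L1N ib.
have bNK := C2_leN iK.
have aal x : `|x| `^ al * `|a x| <= K * lorentz x.
  by rewrite (le_trans _ (MK x))// ler_wpM2l ?powR_ge0// Re_le_normc.
have bal x : `|x| `^ al * `|b x| <= K * lorentz x.
  by rewrite (le_trans _ (MK x))// ler_wpM2l ?powR_ge0// Im_le_normc.
have bNal x : `|x| `^ al * `|- b x| <= K * lorentz x by rewrite normrN.
pose A := trigT a (fun t => - b t); pose B := trigT b a.
have Adec s : `|A s| <= 4 * K * pi * lorentz s by exact: trigT_decay.
have Bdec s : `|B s| <= 4 * K * pi * lorentz s by exact: trigT_decay.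
have Ahol s t : `|A s - A t| <= 4 * K * pi * `|s - t| `^ al by exact: trigT_holder.
have Bhol s t : `|B s - B t| <= 4 * K * pi * `|s - t| `^ al by exact: trigT_holder.
pose G t := ((2 * pi)^-1 * A t) +i* ((2 * pi)^-1 * B t).
have c0 : 0 <= (2 * pi)^-1 :> R by rewrite invr_ge0 mulr_ge0// ltW.
have pin0 : pi != 0 :> R by rewrite gt_eqF.
have two (w : R) : (2 * pi)^-1 * (4 * K * pi * w) + (2 * pi)^-1 * (4 * K * pi * w) = 4 * K * w.
  by move: (pi : R) pin0 => p p0; field.
have cA : continuous A by exact: trigT_continuous.
have cB : continuous B by exact: trigT_continuous.
have qi c : L1 (fun t => c * lorentz t) by exact/L1Zl/L1_lorentz.
have iA : L1 A by apply: L1_le (qi _) Adec; exact: continuous_measurable_fun.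
have iB : L1 B by apply: L1_le (qi _) Bdec; exact: continuous_measurable_fun.
have [ca cb] := (C2_le_continuous rK, C2_le_continuous iK).
exists G; split.
- by apply/classC0; split=> t; apply: cvgMl_tmp; [exact: cA|exact: cB].
- move=> x; rewrite fourierE.
  have -> : Re \o G = fun s => (2 * pi)^-1 * A s by [].
  have -> : Im \o G = fun s => (2 * pi)^-1 * B s by [].
  rewrite inverse_trigT//.
  have -> : (fun t => - Re (G t)) = fun s => (2 * pi)^-1 * - A s.
    by apply/funext => s; rewrite /G /= mulrN.
  have EB : trigT b (fun t => - - a t) = B.
    by congr trigT; apply/funext => y; rewrite opprK.
  have EA : trigT (fun t => - a t) b = fun s => - A s.
    apply/funext => s; rewrite /A -trigTN//.
    by congr trigT; apply/funext => y; rewrite opprK.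
  have := @inverse_trigT b (fun t => - a t) ib (L1N ia) cb.
  rewrite EB EA => /(_ iB (L1N iA) x) ->.
  by apply: complexP.
- move=> t; rewrite (le_trans (normc_le _))//= !normrM !(ger0_norm c0) -two.
  by rewrite lerD// ler_wpM2l.
- move=> s t; rewrite (le_trans (normc_le _))//= -!mulrBr !normrM !(ger0_norm c0) -two.
  by rewrite lerD// ler_wpM2l.
Qed.

End ComplexFourier.

(** * Norms, dilations and the vaguelet bounds *)

Section Vaguelets.
Context {R : realType}.
Local Notation mu := (@lebesgue_measure R).
Local Notation Re := (@complex.Re R).
Local Notation Im := (@complex.Im R).
Implicit Types (f g : R -> R[i]) (s t x y c K al : R) (z w : R[i]).

Lemma L2normE f : L2norm f = Num.sqrt (\int[mu]_t (normc (f t) ^+ 2)).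
Proof.
rewrite /L2norm unlock /Lnorm fine_poweR powR12_sqrt; last first.
  by apply/fine_ge0/integral_ge0 => t _; exact: poweR_ge0.
congr Num.sqrt; rewrite /Rintegral; congr fine; apply: eq_integral => t _.
by rewrite poweR_EFin powR_mulrn// ger0_norm// normc_ge0.
Qed.

Lemma measurable_normc f : measurable_fun setT (Re \o f) ->
  measurable_fun setT (Im \o f) -> measurable_fun setT (fun t => normc (f t)).
Proof.
move=> mr mi.
have -> : (fun t => normc (f t)) =
    (fun t => Num.sqrt ((Re \o f) t ^+ 2 + (Im \o f) t ^+ 2)).
  by apply/funext => t /=; case: (f t).
apply: (measurableT_comp (continuous_measurable_fun (@sqrt_continuous R))).
by apply: measurable_funD; exact: measurable_funX.
Qed.

Lemma dilation_neq0 (j : nat) : 2 ^+ j != 0 :> R.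
Proof. by rewrite expf_eq0 pnatr_eq0 andbF. Qed.

Lemma powR2_half (j : nat) : (2 `^ (j%:R / 2)) ^+ 2 = 2 ^+ j :> R.
Proof.
by rewrite -powR_mulrn ?powR_ge0// -powRrM divfK ?pnatr_eq0// powR_mulrn.
Qed.

Lemma normc_dyadic_sqr f (j : nat) (k : int) t :
  normc (dyadic f j k t) ^+ 2 = 2 ^+ j * normc (f (2 ^+ j * t - k%:~R)) ^+ 2.
Proof.
by rewrite /dyadic normcM exprMn normc_real ger0_norm ?powR_ge0// powR2_half.
Qed.

Lemma L1_dyadic_sqr f (j : nat) (k : int) : L1 (fun t => normc (f t) ^+ 2) ->
  L1 (fun t => normc (dyadic f j k t) ^+ 2).
Proof.
move=> i2; apply: eq_L1 (L1Zl (2 ^+ j) (L1_affine (- k%:~R) (dilation_neq0 j) i2)) => t.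
by rewrite normc_dyadic_sqr.
Qed.

Lemma L2norm_dyadic f (j : nat) (k : int) : L1 (fun t => normc (f t) ^+ 2) ->
  L2norm (dyadic f j k) = L2norm f.
Proof.
move=> i2; rewrite !L2normE; congr Num.sqrt.
rewrite [RHS](int_affine (- k%:~R) (dilation_neq0 j))// -intZl; last first.
  exact: L1_affine (dilation_neq0 j) i2.
apply: eq_int => t; rewrite normc_dyadic_sqr.
by rewrite [`|2 ^+ j|]ger0_norm// exprn_ge0.
Qed.

Lemma L2normZ c f : 0 <= c -> L1 (fun t => normc (f t) ^+ 2) ->
  L2norm (fun t => c%:C * f t) = c * L2norm f.
Proof.
move=> c0 i2; rewrite !L2normE.
have -> : \int[mu]_t (normc (c%:C * f t) ^+ 2) = c ^+ 2 * \int[mu]_t (normc (f t) ^+ 2).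
  rewrite -intZl//; apply: eq_int => t.
  by rewrite normcM exprMn normc_real real_normK ?num_real.
by rewrite sqrtrM ?sqr_ge0// sqrtr_sqr ger0_norm.
Qed.

Lemma L1_normc_sqr K f : measurable_fun setT (fun t => normc (f t)) ->
  (forall t, normc (f t) <= K * lorentz t) -> L1 (fun t => normc (f t) ^+ 2).
Proof.
move=> mf fK; apply: (L1_le _ (L1Zl (K ^+ 2) L1_lorentz)).
  exact: measurable_funX.
move=> t; rewrite ger0_norm ?sqr_ge0//.
have K0 : 0 <= K * lorentz t by rewrite (le_trans (normc_ge0 _) (fK t)).
apply: (@le_trans _ _ ((K * lorentz t) ^+ 2)).
  by rewrite ler_pXn2r// nnegrE normc_ge0.
rewrite exprMn ler_wpM2l ?sqr_ge0// expr2 ler_piMr ?lorentz_ge0//.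
exact: lorentz_le1.
Qed.

Lemma int_lorentz_dilate (S : R) : 0 < S -> L1 (fun t => lorentz (t / S)) /\
  \int[mu]_t lorentz (t / S) = S * pi.
Proof.
move=> S0; have SN0 : S != 0 by rewrite gt_eqF.
have SV0 : S^-1 != 0 by rewrite invr_eq0.
have i1 : L1 (fun t => lorentz (t / S)).
  by apply: eq_L1 (L1_affine 0 SV0 L1_lorentz) => t; rewrite addr0 mulrC.
split=> //; rewrite (int_affine 0 SN0)// gtr0_norm// -lorentz_integral.2.
by congr (_ * _); apply: eq_int => t; rewrite addr0 mulrAC divff// mul1r.
Qed.

(** The value of the transform bounds the L1 norm from below.  On a ball the
    inequality of arithmetic and geometric means compares the L1 norm with the
    square of the L2 norm, and outside a large ball the pointwise bound makes the
    L1 norm small. *)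
Lemma L2norm_lower K c : 0 <= K -> 0 < c -> exists2 nu : R, 0 < nu & forall f,
  measurable_fun setT (Re \o f) -> measurable_fun setT (Im \o f) ->
  (forall t, normc (f t) <= K * lorentz t) ->
  (exists x, c <= normc (fourier f x)) -> nu <= L2norm f.
Proof.
move=> K0 c0; have pi0 : 0 < pi :> R by exact: pi_gt0.
pose d := c / (16 * pi); pose S := 32 * K * pi / c + 1; pose A := (1 + S ^+ 2) / (4 * d).
have d0 : 0 < d by rewrite divr_gt0// mulr_gt0.
have Kpi0 : 0 <= 32 * K * pi by apply: mulr_ge0; [exact: mulr_ge0|exact: ltW].
have S0 : 0 < S by rewrite ltr_pwDr// divr_ge0// ltW.
have A0 : 0 < A.
  by apply: divr_gt0; [rewrite ltr_pwDl// sqr_ge0|exact: mulr_gt0].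
(* [d] and [S] make the first and the last term of [pt] integrate to at most
   [c / 16] each. *)
exists (Num.sqrt (c / (8 * A))); first by rewrite sqrtr_gt0 divr_gt0// mulr_gt0.
move=> f mr mi fK [x cx].
have mf := measurable_normc mr mi.
have iN : L1 (fun t => normc (f t)).
  apply: (L1_le mf (L1Zl K L1_lorentz)) => t.
  by rewrite ger0_norm ?normc_ge0.
have i2 := L1_normc_sqr mf fK.
have c4 : c <= 4 * \int[mu]_t normc (f t).
  have H (a b : R -> R) : measurable_fun setT a -> measurable_fun setT b ->
      (forall t, `|a t| <= normc (f t)) -> (forall t, `|b t| <= normc (f t)) ->
      `|trigT a b x| <= 2 * \int[mu]_t normc (f t).
    by move=> ma mb af bf; rewrite (le_trans (trigT_le x ma mb iN iN af bf))//; lra.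
  have Hr t : `|Re (f t)| <= normc (f t) by exact: Re_le_normc.
  have Hi t : `|Im (f t)| <= normc (f t) by exact: Im_le_normc.
  rewrite (le_trans cx)// (le_trans (normc_le _))// fourierE /=.
  have h1 := H _ _ mr mi Hr Hi.
  have h2 : `|trigT (Im \o f) (fun t => - Re (f t)) x| <= 2 * \int[mu]_t normc (f t).
    apply: H => //; first exact: (measurableT_comp (@oppr_measurable _ _) mr).
    by move=> t; rewrite normrN.
  by move: h1 h2; lra.
have [iS ES] := int_lorentz_dilate S0.
have pt t : normc (f t) <= d * lorentz t + (A * normc (f t) ^+ 2 +
    2 * K / S ^+ 2 * lorentz (t / S)).
  set g := normc (f t); have g0 : 0 <= g by exact: normc_ge0.
  have t2 := sqr_ge0 t; have S2 : 0 < S ^+ 2 by exact: exprn_gt0.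
  have r1 : 0 <= A * g ^+ 2 by rewrite mulr_ge0 ?sqr_ge0// ltW.
  have r2 : 0 <= 2 * K / S ^+ 2 * lorentz (t / S).
    by rewrite mulr_ge0 ?lorentz_ge0// divr_ge0 ?mulr_ge0// ltW.
  have r3 : 0 <= d * lorentz t by rewrite mulr_ge0 ?lorentz_ge0// ltW.
  have d4 : 0 < 4 * d by rewrite mulr_gt0.
  have [tS|St] := leP (t ^+ 2) (S ^+ 2).
    suff : g <= d * lorentz t + A * g ^+ 2 by lra.
    apply: (@le_trans _ _ (d * lorentz t + (1 + t ^+ 2) / (4 * d) * g ^+ 2)).
      have u0 : 0 < 1 + t ^+ 2 by rewrite ltr_pwDl.
      have -> : d * lorentz t + (1 + t ^+ 2) / (4 * d) * g ^+ 2 =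
          g + (2 * d - (1 + t ^+ 2) * g) ^+ 2 / (4 * d * (1 + t ^+ 2)).
        by rewrite /lorentz; field; rewrite !gt_eqF.
      by rewrite lerDl divr_ge0 ?sqr_ge0// ltW// mulr_gt0.
    by rewrite lerD2l ler_wpM2r ?sqr_ge0// ler_wpM2r ?lerD2l// invr_ge0 ltW.
  suff : g <= 2 * K / S ^+ 2 * lorentz (t / S) by lra.
  rewrite (le_trans (fK t))//.
  have -> : 2 * K / S ^+ 2 * lorentz (t / S) = K * (2 / (S ^+ 2 + t ^+ 2)).
    have -> : 2 * K / S ^+ 2 * lorentz (t / S) = 2 * K / S * (S^-1 * lorentz (t / S)).
      by field; rewrite gt_eqF.
    rewrite lorentz_scaled_le//.
    have v0 : 0 < S ^+ 2 + t ^+ 2 by rewrite ltr_pwDl.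
    by field; rewrite (gt_eqF v0) (gt_eqF S0).
  rewrite ler_wpM2l// /lorentz ler_pdivlMr; last by rewrite ltr_pwDl.
  rewrite mulrC ler_pdivrMr; [by nra|by rewrite ltr_pwDl].
have main : \int[mu]_t normc (f t) <= d * pi + (A * \int[mu]_t (normc (f t) ^+ 2) +
    2 * K / S ^+ 2 * (S * pi)).
  rewrite -lorentz_integral.2 in ES *.
  rewrite -ES -!intZl//; try exact: L1_lorentz.
  rewrite -!intD; do ?[apply: L1D|apply: L1Zl] => //; try exact: L1_lorentz.
  by apply: le_int; do ?[apply: L1D|apply: L1Zl] => //; exact: L1_lorentz.
have e1 : d * pi = c / 16.
  by rewrite /d; move: (pi : R) pi0 => p p0; field; rewrite gt_eqF.
have e2 : 2 * K / S ^+ 2 * (S * pi) <= c / 16.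
  have -> : 2 * K / S ^+ 2 * (S * pi) = 2 * K * pi / S.
    by move: (pi : R) => p; field; rewrite gt_eqF.
  rewrite ler_pdivrMr// /S.
  have -> : c / 16 * (32 * K * pi / c + 1) = 2 * K * pi + c / 16.
    by move: (pi : R) => p; field; rewrite gt_eqF.
  by rewrite lerDl divr_ge0// ltW.
rewrite L2normE ler_sqrt ?Rintegral_ge0//; last by move=> t _; exact: sqr_ge0.
rewrite ler_pdivrMr; last exact: mulr_gt0.
set I := \int[mu]_t (normc (f t) ^+ 2) in main *.
set J := \int[mu]_t normc (f t) in main c4.
have -> : I * (8 * A) = 8 * (A * I) by ring.
by move: main c4; rewrite e1; move: e2; lra.
Qed.

Lemma lorentz_le_powR x al : al <= 1 -> lorentz x <= 2 * (1 + `|x|) `^ (- 1 - al).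
Proof.
move=> al1; have u1 : 1 <= 1 + `|x| by rewrite lerDl.
have u0 : 0 < 1 + `|x| by rewrite (lt_le_trans ltr01).
apply: (@le_trans _ _ (2 * (1 + `|x|) `^ (- 2%:R))).
  rewrite powR_invn; last exact: ltW.
  rewrite /lorentz ler_pdivlMr ?exprn_gt0//.
  rewrite mulrC ler_pdivrMr ?ltr_pwDl ?sqr_ge0//.
  by have := sqr_ge0 (1 - `|x|); rewrite -(real_normK (num_real x)); nra.
by rewrite ler_wpM2l// ler_powR//; lra.
Qed.

Lemma cintegral_scale c f : cintegrable f -> cintegral f = 0 ->
  cintegral (fun t => c%:C * f t) = 0.
Proof.
move=> [ir ii] [E1 E2]; rewrite /cintegral.
rewrite (eq_int (fun t => ReZ c (f t))) (eq_int (fun t => ImZ c (f t))).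
by rewrite (intZl c ir) (intZl c ii) /= E1 E2 mulr0.
Qed.

(** Vaguelets are the dyadic dilations and translations of profiles that satisfy
    the bounds of the unit scale uniformly. *)
Lemma vaguelets_of_profiles (F : nat -> int -> R -> R[i]) (G : nat -> R -> R[i]) K nu al :
  0 < al <= 2^-1 -> 0 < nu ->
  (forall j, cintegrable (G j)) ->
  (forall j k, cintegral (dyadic (G j) j k) = 0) ->
  (forall j t, normc (G j t) <= K * lorentz t) ->
  (forall j s t, normc (G j s - G j t) <= K * `|s - t| `^ al) ->
  (forall j, nu <= L2norm (G j)) ->
  (forall j k t, F j k t = dyadic (G j) j k t / (L2norm (G j))%:C) ->
  vaguelets F.
Proof.
move=> /andP[al0 al1] nu0 iG G0 GK Gal nuG FE.
have K0 : 0 <= K.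
  by have := le_trans (normc_ge0 _) (GK 0 0); rewrite pmulr_lge0// lorentz_gt0.
have L0 j : 0 < L2norm (G j) by exact: lt_le_trans (nuG j).
pose b j : R := 2 `^ (j%:R / 2).
have b0 j : 0 <= b j by exact: powR_ge0.
have FE' j k t : F j k t = ((L2norm (G j))^-1)%:C * dyadic (G j) j k t.
  by rewrite FE mulrC -fmorphV.
have nF (j : nat) (u : R) : 0 <= u -> b j * u / L2norm (G j) <= nu^-1 * b j * u.
  move=> u0; rewrite mulrC -mulrA ler_wpM2r ?mulr_ge0//.
  by rewrite lef_pV2 ?posrE.
(* The profiles decay like [`|x| ^- 2], which leaves room for any exponent between
   [al] and 1. *)
exists (2 * K / nu), (3 / 4), al; split => //; try lra.
move=> j k; split.
- move=> t; rewrite FE' normcM normc_real gtr0_norm ?invr_gt0//.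
  rewrite /dyadic normcM normc_real ger0_norm ?powR_ge0//.
  rewrite mulrC; apply: (le_trans (nF _ _ (normc_ge0 _))).
  rewrite -[X in `|X|]/(2 ^+ j * t - k%:~R); set x := 2 ^+ j * t - _.
  apply: (@le_trans _ _ (nu^-1 * b j * (K * lorentz x))).
    by rewrite ler_wpM2l ?GK// mulr_ge0// invr_ge0 ltW.
  have -> : 2 * K / nu * 2 `^ (j%:R / 2) * (1 + `|x|) `^ (-1 - 3 / 4) =
      nu^-1 * b j * (K * (2 * (1 + `|x|) `^ (-1 - 3 / 4))) by rewrite /b; ring.
  rewrite ler_wpM2l ?mulr_ge0 ?invr_ge0 ?(ltW nu0)// ler_wpM2l//.
  by apply: lorentz_le_powR; lra.
- rewrite (_ : F j k = fun t => ((L2norm (G j))^-1)%:C * dyadic (G j) j k t).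
    apply: cintegral_scale => //; exact: cintegrable_dyadic.
  by apply/funext => t; exact: FE'.
- move=> s t; rewrite !FE' -mulrBr normcM normc_real gtr0_norm ?invr_gt0//.
  rewrite /dyadic -mulrBr normcM normc_real ger0_norm ?powR_ge0//.
  rewrite mulrC; apply: (le_trans (nF _ _ (normc_ge0 _))).
  set x := 2 ^+ j * s - _; set y := 2 ^+ j * t - _.
  apply: (@le_trans _ _ (nu^-1 * b j * (K * `|x - y| `^ al))).
    by rewrite ler_wpM2l ?Gal// mulr_ge0// invr_ge0 ltW.
  have -> : `|x - y| `^ al = 2 `^ (j%:R * al) * `|s - t| `^ al.
    have -> : x - y = 2 ^+ j * (s - t) by rewrite /x /y; ring.
    by rewrite normrM powRM// ger0_norm ?exprn_ge0// -powR_mulrn// -powRrM.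
  have -> : 2 `^ (j%:R * (2^-1 + al)) = b j * 2 `^ (j%:R * al) :> R.
    by rewrite mulrDr powRD// pnatr_eq0 implybT.
  have -> : 2 * K / nu * (b j * 2 `^ (j%:R * al)) * `|s - t| `^ al =
    2 * (nu^-1 * b j * (K * (2 `^ (j%:R * al) * `|s - t| `^ al))) by ring.
  by rewrite ler_peMl ?ler1n// !mulr_ge0 ?invr_ge0 ?(ltW nu0) ?powR_ge0.
Qed.

Lemma vaguelets0 (F : nat -> int -> R -> R[i]) : (forall j k t, F j k t = 0) -> vaguelets F.
Proof.
move=> F0; exists 0, (3 / 4), (2^-1); split; try lra.
move=> j k; split=> [t||s t]; rewrite ?F0 ?subrr ?mul0r ?mul0r//.
- by rewrite [normc _]Normc.normc0.
- have Er : (fun t => Re (F j k t)) =1 (fun=> 0) by move=> t; rewrite F0.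
  have Ei : (fun t => Im (F j k t)) =1 (fun=> 0) by move=> t; rewrite F0.
  by rewrite /cintegral (eq_int Er) (eq_int Ei) int0.
- by rewrite [normc _]Normc.normc0.
Qed.

End Vaguelets.

(** * Vanishing moments *)

Section Moments.
Context {R : realType}.
Local Notation mu := (@lebesgue_measure R).
Implicit Types (a b u : R -> R) (s t x y c K : R) (m n : nat).

(** Square integrability controls [u] on the bounded set where the decay is not
    assumed. *)
Lemma L1_moment u n (N : nat) c T : u \in Lfun mu 2%:E -> (n <= N)%N ->
  (forall t, T <= `|t| -> `|u t| <= c * (1 + t ^+ 2) `^ (- (N%:R / 2) - 1)) ->
  L1 (fun t => t ^+ n * u t).
Proof.
move=> u2 nN udec.
have mu_ : measurable_fun setT u by move: u2; rewrite inE => /andP[]; rewrite inE.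
have iu2 : L1 (fun t => u t ^+ 2) := Lfun2_integrable_sqr u2.
pose W := (1 + `|T|) ^+ n.
have W0 : 0 <= W by rewrite exprn_ge0.
apply: (@L1_le _ _ (fun t => W * ((1 + T ^+ 2) * lorentz t + u t ^+ 2) + `|c| * lorentz t)).
- by apply: measurable_funM => //; exact: measurable_funX.
- apply: L1D; [apply: L1Zl; apply: L1D => //|]; apply: L1Zl; exact: L1_lorentz.
move=> t; have q0 : 0 < 1 + t ^+ 2 by rewrite ltr_pwDl// sqr_ge0.
have T2 := sqr_ge0 T; have u20 := sqr_ge0 (u t); have t20 := sqr_ge0 t.
have r1 : 0 <= (1 + T ^+ 2) * lorentz t by rewrite mulr_ge0 ?lorentz_ge0// addr_ge0.
have r2 : 0 <= `|c| * lorentz t by rewrite mulr_ge0 ?lorentz_ge0.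
rewrite normrM normrX; have [Tt|tT] := leP T `|t|.
  rewrite -[leLHS]add0r lerD ?mulr_ge0 ?addr_ge0//.
  apply: (@le_trans _ _ ((1 + t ^+ 2) `^ (N%:R / 2) * (`|c| * (1 + t ^+ 2) `^ (- (N%:R / 2) - 1)))).
    apply: ler_pM => //.
      apply: (@le_trans _ _ ((1 + t ^+ 2) `^ (n%:R / 2))); last first.
        by rewrite ler_powR ?lerDl// ler_wpM2r// ler_nat.
      have -> : `|t| ^+ n = (t ^+ 2) `^ (n%:R / 2).
        rewrite -(real_normK (num_real t)) -(powR_mulrn 2)// -powRrM.
        by rewrite mulrCA divff// mulr1 powR_mulrn.
      by rewrite ge0_ler_powR ?nnegrE ?divr_ge0 ?lerDr// ltW.
    rewrite (le_trans (udec t Tt))// ler_wpM2r ?powR_ge0//; exact: ler_norm.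
  rewrite mulrCA -powRD; last by rewrite (gt_eqF q0) implybT.
  by rewrite addrA subrr sub0r powR_inv1 ?(ltW q0).
rewrite -[leLHS]addr0 lerD//; apply: ler_pM => //.
  rewrite /W lerXn2r ?nnegrE ?addr_ge0//.
  by rewrite (le_trans (ltW tT))// (le_trans (ler_norm T))// lerDr.
have h1 : 1 <= (1 + T ^+ 2) * lorentz t.
  rewrite ler_pdivlMr// mul1r lerD2l -(real_normK (num_real t)) -(real_normK (num_real T)).
  rewrite ler_pXn2r ?nnegrE// (le_trans (ltW tT))//; exact: ler_norm.
have : `|u t| <= 1 + u t ^+ 2 by rewrite -(real_normK (num_real (u t))); nra.
by move: h1; move: ((1 + T ^+ 2) * lorentz t) => v; lra.
Qed.

Lemma trigT_derive a b x : L1 a -> L1 b -> L1 (fun t => t * a t) ->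
  L1 (fun t => t * b t) ->
  is_derive x 1 (trigT a b) (trigT (fun t => t * b t) (fun t => - (t * a t)) x).
Proof.
move=> ia ib ita itb.
pose f y t := cos (y * t) * a t + sin (y * t) * b t.
have df y t : is_derive y 1 (f ^~ t) (cos (y * t) * (t * b t) + sin (y * t) * - (t * a t)).
  have dl : is_derive y 1 (fun y => y * t) t.
    by apply: der_eq (derM (der_id y) (der_cst t y)) _; rewrite mulr0 addr0 mul1r.
  have ds := @der_comp _ _ (fun y => y * t) _ _ _ (is_derive_sin (y * t)) dl.
  have dc := @der_comp _ _ (fun y => y * t) _ _ _ (is_derive_cos (y * t)) dl.
  by apply: der_eq (derD (derM dc (der_cst (a t) y)) (derM ds (der_cst (b t) y))) _; ring.
have d1f y t : partial1of2 f y t = cos (y * t) * (t * b t) + sin (y * t) * - (t * a t).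
  by rewrite partial1of2E; have d := df y t; rewrite derive_val.
pose g t := `|t * b t| + `|t * a t|.
have g0 t : 0 <= g t by rewrite addr_ge0.
have ig : L1 g by apply: L1D; exact: L1_norm.
have gub y t : `|partial1of2 f y t| <= g t.
  have le1 (v w : R) : `|v| <= 1 -> `|v * w| <= `|w|.
    by move=> v1; rewrite normrM ler_piMl.
  rewrite d1f (le_trans (ler_normD _ _))// -[X in _ <= _ + X]normrN.
  by rewrite lerD// le1 ?cos_max ?sin_max.
have xI : [set` `]x - 1, x + 1[] x by rewrite /= in_itv/= ltrBlDr ltrDl ltr01.
have i_f y : [set` `]x - 1, x + 1[] y -> L1 (f y) by move=> _; exact: L1_trigT.
have dfI y t : [set` `]x - 1, x + 1[] y -> [set: R] t -> derivable (f ^~ t) y 1.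
  by move=> _ _; have d := df y t; exact: ex_derive.
have gI y t : [set` `]x - 1, x + 1[] y -> [set: R] t -> `|partial1of2 f y t| <= g t.
  by move=> _ _; exact: gub.
have D := @derivable_under_integral R _ _ mu f setT measurableT x _ _ xI i_f dfI g g0 ig gI.
have E := @differentiation_under_integral R _ _ mu f setT measurableT x _ _ xI i_f dfI g g0 ig gI.
apply: DeriveDef => //.
rewrite -derive1E [LHS]E; apply: eq_int => t; exact: d1f.
Qed.

(** A derivative of the transform multiplies the pair [(a, b)] by the variable and
    rotates it, so that the derivatives at 0 are moments up to sign. *)
Lemma derive1n_trigT0 m a b :
  (forall i, (i <= m)%N -> L1 (fun t => t ^+ i * a t) /\ L1 (fun t => t ^+ i * b t)) ->
  \int[mu]_t (t ^+ m * a t) = 0 -> \int[mu]_t (t ^+ m * b t) = 0 ->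
  derive1n m (trigT a b) 0 = 0.
Proof.
elim: m a b => [|m IH] a b iab a0 b0.
  rewrite derive1n0 -[RHS]a0; apply: eq_int => t.
  by rewrite mul0r cos0 sin0 mul0r addr0 expr0.
have i0 (c : R -> R) : L1 (fun t => t ^+ 0 * c t) -> L1 c.
  by apply: eq_L1 => t; rewrite mul1r.
have [/i0 ia /i0 ib] := iab 0%N (leq0n _).
have [ita itb] := iab 1%N (ltn0Sn _).
rewrite /derive1n iterSr -/(derive1n m _).
have -> : derive1 (trigT a b) = trigT (fun t => t * b t) (fun t => - (t * a t)).
  apply/funext => x; rewrite derive1E.
  by have d := trigT_derive x ia ib ita itb; rewrite derive_val.
apply: IH => [i im||].
- have [ja jb] := iab i.+1 im.
  split; first by apply: eq_L1 jb => t; rewrite exprSr mulrA.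
  by apply: eq_L1 (L1N ja) => t; rewrite mulrN exprSr mulrA.
- by rewrite -[RHS]b0; apply: eq_int => t; rewrite exprSr mulrA.
- have [ja _] := iab m.+1 (leqnn _).
  rewrite -[RHS]oppr0 -[in RHS]a0 -intN//; apply: eq_int => t.
  by rewrite mulrN exprSr mulrA.
Qed.

Lemma continuous_bounded u r : continuous u ->
  exists2 K : R, 0 <= K & forall x, `|x| <= r -> `|u x| <= K.
Proof.
move=> cu; have [r0|r0] := leP 0 r; last first.
  by exists 0 => // x xr; have := le_trans (normr_ge0 x) xr; rewrite leNgt r0.
have rr : - r <= r by lra.
have cn : {within `[- r, r], continuous (fun x => `|u x|)}.
  apply: continuous_subspaceT => x.
  by apply: (@continuous_comp _ _ _ u (fun z : R => `|z|)); [exact: cu|exact: norm_continuous].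
have [c _ H] := EVT_max rr cn.
by exists `|u c| => // x; rewrite ler_norml => xr; apply: H; rewrite in_itv.
Qed.

(** Taylor's formula, with the mean value inequality applied down from the
    highest derivative. *)
Lemma flat_derive1n (N : nat) u r :
  (forall m x, (m < N)%N -> derivable (derive1n m u) x 1) ->
  continuous (derive1n N u) ->
  (forall m, (m < N)%N -> derive1n m u 0 = 0) ->
  exists2 K : R, 0 <= K & forall m y, (m <= N)%N -> `|y| <= r ->
    `|derive1n m u y| <= K * `|y| ^+ (N - m).
Proof.
move=> du cu u0; have [K K0 HK] := continuous_bounded r cu; exists K => //.
suff H i y : (i <= N)%N -> `|y| <= r -> `|derive1n (N - i) u y| <= K * `|y| ^+ i.
  by move=> m y mN yr; rewrite -[in X in X <= _](subKn mN); apply: H => //; exact: leq_subr.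
elim: i y => [|i IH] y iN yr; first by rewrite subn0 expr0 mulr1 HK.
have d x : is_derive x 1 (derive1n (N - i.+1) u) (derive1n (N - i) u x).
  apply: DeriveDef; first by apply: du; rewrite ltn_subrL; case: (N) iN.
  by rewrite -derive1E -derive1nS subnSK.
rewrite -[X in `|X|]subr0 -(u0 (N - i.+1)%N); last by rewrite ltn_subrL; case: (N) iN.
rewrite exprSr mulrA -[X in _ * `|X|]subr0; apply: (norm_diff_le_deriv d) => x.
rewrite normr0 (max_idPr _)// => xy.
rewrite (le_trans (IH _ (ltnW iN) _)) ?(le_trans xy)//.
by rewrite ler_wpM2l// lerXn2r ?nnegrE.
Qed.

End Moments.

(** * Frequency multipliers acting on a wavelet *)

Section Multiplier.
Context {R : realType}.
Local Notation mu := (@lebesgue_measure R).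
Local Notation Re := (@complex.Re R).
Local Notation Im := (@complex.Im R).
Implicit Types (u : R -> R) (f g H : R -> R[i]) (U V : nat -> R -> R) 
  (s t x y c B K : R) (j k l : nat).

(** [U 1] and [U 2] are the successive derivatives of [U 0]; the values at larger
    indices are arbitrary. *)
Definition jet2 U := [/\ forall x, is_derive x 1 (U 0%N) (U 1%N x),
  forall x, is_derive x 1 (U 1%N) (U 2%N x) & continuous (U 2%N)].

Lemma jet2_classC (N : nat) u : (2 <= N)%N ->
  (forall m x, (m < N)%N -> derivable (derive1n m u) x 1) ->
  continuous (derive1n N u) -> jet2 (fun k => derive1n k u).
Proof.
move=> N2 du cu.
have d m x : (m < N)%N -> is_derive x 1 (derive1n m u) (derive1n m.+1 u x).
  by move=> mN; apply: DeriveDef; [exact: du|rewrite -derive1E -derive1nS].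
split=> [x|x|]; [exact: (d 0%N x (ltnW N2))|exact: (d 1%N x N2)|].
move: N2; rewrite leq_eqVlt => /predU1P[E|N3]; first by rewrite E.
exact: (der_continuous (fun x => d 2%N x N3)).
Qed.

Lemma jet2_dilate U c y0 : jet2 U -> jet2 (fun k y => c * y0 ^+ k * U k (y0 * y)).
Proof.
move=> [d1 d2 c2].
have dl x : is_derive x 1 (fun y => y0 * y) y0.
  by apply: der_eq (derZ y0 (der_id x)) _; rewrite mulr1.
split=> [x|x|x].
- apply: der_eq (derZ (c * y0 ^+ 0) (@der_comp _ _ (fun y => y0 * y) _ _ _ (d1 _) (dl x))) _.
  by ring.
- apply: der_eq (derZ (c * y0 ^+ 1) (@der_comp _ _ (fun y => y0 * y) _ _ _ (d2 _) (dl x))) _.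
  by ring.
- apply: cvgMl_tmp; apply: (@continuous_comp _ _ _ (fun y => y0 * y) (U 2%N)).
    exact: mulrl_continuous.
  exact: c2.
Qed.

Lemma C2_le_jets U V U' V' B (s : R) : `|s| <= 1 ->
  jet2 U -> jet2 V -> jet2 U' -> jet2 V' ->
  (forall k l y, (k <= 2)%N -> (l <= 2)%N ->
     `|U k y * V l y| <= B * lorentz y /\ `|U' k y * V' l y| <= B * lorentz y) ->
  C2_le (8 * B) (fun y => U 0%N y * V 0%N y + s * (U' 0%N y * V' 0%N y)).
Proof.
move=> s1 [dU0 dU1 cU2] [dV0 dV1 cV2] [dU'0 dU'1 cU'2] [dV'0 dV'1 cV'2] HB.
have cU0 := der_continuous dU0; have cU1 := der_continuous dU1.
have cV0 := der_continuous dV0; have cV1 := der_continuous dV1.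
have cU'0 := der_continuous dU'0; have cU'1 := der_continuous dU'1.
have cV'0 := der_continuous dV'0; have cV'1 := der_continuous dV'1.
exists (fun y => (U 1%N y * V 0%N y + U 0%N y * V 1%N y) +
  s * (U' 1%N y * V' 0%N y + U' 0%N y * V' 1%N y)).
exists (fun y => ((U 2%N y * V 0%N y + U 1%N y * V 1%N y) +
  (U 1%N y * V 1%N y + U 0%N y * V 2%N y)) +
  s * ((U' 2%N y * V' 0%N y + U' 1%N y * V' 1%N y) +
  (U' 1%N y * V' 1%N y + U' 0%N y * V' 2%N y))).
have HU k l y : (k <= 2)%N -> (l <= 2)%N -> `|U k y * V l y| <= B * lorentz y.
  by move=> k2 l2; have [] := HB k l y k2 l2.
have HU' k l y : (k <= 2)%N -> (l <= 2)%N -> `|s * (U' k y * V' l y)| <= B * lorentz y.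
  move=> k2 l2; have [_ h] := HB k l y k2 l2.
  by rewrite normrM (le_trans _ h)// ler_piMl.
split.
- move=> x; apply: (derD (derM (dU0 x) (dV0 x)) (derZ s (derM (dU'0 x) (dV'0 x)))).
- move=> x; exact: (derD (derD (derM (dU1 x) (dV0 x)) (derM (dU0 x) (dV1 x)))
    (derZ s (derD (derM (dU'1 x) (dV'0 x)) (derM (dU'0 x) (dV'1 x))))).
- move=> x; apply: cvgD; [|apply: cvgMl_tmp]; do 2 apply: cvgD.
  + exact: cvgM (cU2 x) (cV0 x).
  + exact: cvgM (cU1 x) (cV1 x).
  + exact: cvgM (cU1 x) (cV1 x).
  + exact: cvgM (cU0 x) (cV2 x).
  + exact: cvgM (cU'2 x) (cV'0 x).
  + exact: cvgM (cU'1 x) (cV'1 x).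
  + exact: cvgM (cU'1 x) (cV'1 x).
  + exact: cvgM (cU'0 x) (cV'2 x).
move=> y; have w0 : 0 <= B * lorentz y by exact: le_trans (HU 0%N 0%N y isT isT).
rewrite !mulrDr -!mulrA; move: (HU) (HU') w0 => /(_ _ _ y) hU /(_ _ _ y) hU'.
have a00 := hU 0%N 0%N isT isT; have a01 := hU 0%N 1%N isT isT; have a02 := hU 0%N 2%N isT isT.
have a10 := hU 1%N 0%N isT isT; have a11 := hU 1%N 1%N isT isT; have a20 := hU 2%N 0%N isT isT.
have b00 := hU' 0%N 0%N isT isT; have b01 := hU' 0%N 1%N isT isT; have b02 := hU' 0%N 2%N isT isT.
have b10 := hU' 1%N 0%N isT isT; have b11 := hU' 1%N 1%N isT isT; have b20 := hU' 2%N 0%N isT isT.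
move: (B * lorentz y) a00 a01 a02 a10 a11 a20 b00 b01 b02 b10 b11 b20 => w.
move=> a00 a01 a02 a10 a11 a20 b00 b01 b02 b10 b11 b20 w0.
have tri (p q vp vq : R) : `|p| <= vp -> `|q| <= vq -> `|p + q| <= vp + vq.
  by move=> hp hq; rewrite (le_trans (ler_normD _ _))// lerD.
split.
- by rewrite (le_trans (tri _ _ _ _ a00 b00))//; lra.
- by rewrite (le_trans (tri _ _ _ _ (tri _ _ _ _ a10 a01) (tri _ _ _ _ b10 b01)))//; lra.
- rewrite (le_trans (tri _ _ _ _
    (tri _ _ _ _ (tri _ _ _ _ a20 a11) (tri _ _ _ _ a11 a02))
    (tri _ _ _ _ (tri _ _ _ _ b20 b11) (tri _ _ _ _ b11 b02))))//; lra.
Qed.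

Lemma powR_decay_lorentz eta y : 0 <= eta -> (1 + `|y|) `^ (- (2 + eta)) <= lorentz y.
Proof.
move=> eta0; have u1 : 1 <= 1 + `|y| by rewrite lerDl.
have u0 : 0 < 1 + `|y| by rewrite (lt_le_trans ltr01).
apply: (@le_trans _ _ ((1 + `|y|) `^ (- 2%:R))); first by rewrite ler_powR//; lra.
rewrite powR_invn; last exact: ltW.
rewrite /lorentz lef_pV2 ?posrE ?exprn_gt0 ?ltr_pwDl ?sqr_ge0//.
by rewrite -(real_normK (num_real y)); have := normr_ge0 y; nra.
Qed.

Lemma powR_decay_holder al eta y : 0 <= al <= eta ->
  `|y| `^ al * (1 + `|y|) `^ (- (2 + eta)) <= lorentz y.
Proof.
move=> /andP[al0 al_eta]; have u1 : 1 <= 1 + `|y| by rewrite lerDl.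
have u0 : 0 < 1 + `|y| by rewrite (lt_le_trans ltr01).
apply: le_trans (powR_decay_lorentz y (_ : 0 <= eta - al)); last by lra.
apply: (@le_trans _ _ ((1 + `|y|) `^ al * (1 + `|y|) `^ (- (2 + eta)))).
  by rewrite ler_wpM2r ?powR_ge0// ge0_ler_powR// ?nnegrE ?lerDr// ltW.
by rewrite -powRD ?(gt_eqF u0) ?implybT// ler_powR//; lra.
Qed.

Lemma fourierZ c f x : cintegrable f ->
  fourier (fun t => c%:C * f t) x = c%:C * fourier f x.
Proof.
move=> [ir ii]; rewrite !fourierE.
have -> : Re \o (fun t => c%:C * f t) = fun t => c * (Re \o f) t.
  by apply/funext => t; rewrite /= ReZ.
have -> : Im \o (fun t => c%:C * f t) = fun t => c * (Im \o f) t.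
  by apply/funext => t; rewrite /= ImZ.
have -> : (fun t => - Re (c%:C * f t)) = fun t => c * - Re (f t).
  by apply/funext => t; rewrite ReZ mulrN.
have iN : L1 (fun t => - Re (f t)) by exact: L1N.
by rewrite !trigTZ//; apply: complexP; rewrite ?ReZ ?ImZ.
Qed.

Lemma cintegrableZ c f : cintegrable f -> cintegrable (fun t => c%:C * f t).
Proof.
move=> [ir ii]; split.
  by apply: eq_L1 (L1Zl c ir) => t; rewrite /= ReZ.
by apply: eq_L1 (L1Zl c ii) => t; rewrite /= ImZ.
Qed.

Lemma classC0Z c f : classC 0 f -> classC 0 (fun t => c%:C * f t).
Proof.
move=> /classC0[cr ci]; apply/classC0; split=> t.
  rewrite (_ : Re \o _ = fun s => c * (Re \o f) s); last by apply/funext => s; rewrite /= ReZ.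
  by apply: cvgMl_tmp; exact: cr.
rewrite (_ : Im \o _ = fun s => c * (Im \o f) s); last by apply/funext => s; rewrite /= ImZ.
by apply: cvgMl_tmp; exact: ci.
Qed.

Lemma classC0_dyadic f (j : nat) (k : int) : classC 0 f -> classC 0 (dyadic f j k).
Proof.
move=> cf; apply: classC0Z; move: cf => /classC0[cr ci]; apply/classC0.
have ca : continuous (fun t => 2 ^+ j * t - k%:~R : R).
  by move=> t; apply: cvgB; [exact: mulrl_continuous|exact: cvg_cst].
split=> t.
  by apply: (@continuous_comp _ _ _ (fun t => 2 ^+ j * t - k%:~R) (Re \o f)); [exact: ca|exact: cr].
by apply: (@continuous_comp _ _ _ (fun t => 2 ^+ j * t - k%:~R) (Im \o f)); [exact: ca|exact: ci].
Qed.

End Multiplier.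

Section UniformBounds.
Context {R : realType}.
Local Notation mu := (@lebesgue_measure R).
Local Notation Re := (@complex.Re R).
Local Notation Im := (@complex.Im R).
Implicit Types (u : R -> R) (f g H : R -> R[i]) (U V : nat -> R -> R)
  (s t x y c d e eps B K : R) (j k l : nat).

Lemma powR_away0 eps y d a : 0 < eps <= 1 -> eps <= `|y| -> 0 <= d ->
  - (d + 2) <= a <= d -> `|y| `^ a <= eps `^ (- (d + 2)) * (1 + `|y|) `^ d.
Proof.
move=> /andP[eps0 eps1] epsy d0 /andP[da ad].
have y0 : 0 < `|y| := lt_le_trans eps0 epsy.
have u1 : 1 <= 1 + `|y| by rewrite lerDl.
have d2 : 0 <= d + 2 by rewrite addr_ge0.
have E1 : 1 <= eps `^ (- (d + 2)).
  rewrite -[leLHS](powRr0 eps) ger_powR//; first by rewrite eps0.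
  by lra.
have D1 : 1 <= (1 + `|y|) `^ d by have := ler_powR u1 d0; rewrite powRr0.
have [y1|/ltW y1] := leP 1 `|y|.
  rewrite -[leLHS]mul1r; apply: ler_pM => //.
  rewrite (le_trans (ler_powR y1 ad))// ge0_ler_powR// ?nnegrE ?lerDr// (le_trans _ u1)//.
rewrite -[leLHS]mulr1; apply: ler_pM => //.
apply: (@le_trans _ _ (`|y| `^ (- (d + 2)))); first by rewrite ger_powR// y0.
by rewrite !powRN lef_pV2 ?posrE ?powR_gt0// ge0_ler_powR// nnegrE ltW.
Qed.

Lemma powR_dilate j k e y : 2 `^ (j%:R * e) * (2 ^+ j) ^+ k *
  `|2 ^+ j * y| `^ (- e - k%:R) = `|y| `^ (- e - k%:R).
Proof.
have p0 : 0 <= 2 ^+ j :> R by exact: exprn_ge0.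
rewrite normrM (ger0_norm p0) powRM// mulrA -[RHS]mul1r; congr (_ * _).
rewrite -[X in X ^+ k](powR_mulrn j)// -(powR_mulrn k) ?powR_ge0//.
rewrite -[X in X `^ (- e - k%:R)](powR_mulrn j)// -!powRrM.
rewrite -!powRD ?pnatr_eq0 ?implybT//.
rewrite [X in 2 `^ X](_ : _ = 0) ?powRr0//; ring.
Qed.

(** Away from 0 the growth of the multiplier is absorbed by the decay of [V];
    near 0 the singular bound [`|x| ^- (N - 2)] of the rescaled multiplier is
    compensated by the vanishing of [V], up to its second derivative. *)
Lemma rescaled_product_bound (N : nat) e d eta Cp C K0 K1 eps : (2 <= N)%N ->
  0 < eps <= 1 -> `|e| <= d -> 0 <= eta -> 0 <= Cp -> 0 <= C -> 0 <= K0 -> 0 <= K1 ->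
  exists2 B, 0 <= B & forall U V,
  (forall k x, (k <= 2)%N -> eps < `|x| -> `|U k x| <= C * `|x| `^ (- e - k%:R)) ->
  (forall j k x, (1 <= j)%N -> (k <= 2)%N -> `|x| <= eps -> (x = 0 -> N = 2%N) ->
    2 `^ (j%:R * e) * (2 ^+ j) ^+ k * `|U k (2 ^+ j * x)| <= C / `|x| ^+ (N - 2)) ->
  (forall k x, (k <= 2)%N -> `|x| <= 1 -> `|U k x| <= K0) ->
  (forall l y, (l <= 2)%N -> `|V l y| <= Cp / (1 + `|y|) `^ (d + (2 + eta))) ->
  (forall l y, (l <= 2)%N -> `|y| <= 1 -> `|V l y| <= K1 * `|y| ^+ (N - l)) ->
  forall j k l y, (k <= 2)%N -> (l <= 2)%N ->
  `|2 `^ (j%:R * e) * (2 ^+ j) ^+ k * U k (2 ^+ j * y) * V l y| <=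
    B * (1 + `|y|) `^ (- (2 + eta)).
Proof.
move=> N2 eps01 ed eta0 Cp0 C0 K00 K10; have /andP[eps0 eps1] := eps01.
have d0 : 0 <= d by exact: le_trans ed.
pose B1 := C * eps `^ (- (d + 2)) * Cp; pose B2 := (C + K0) * K1 * 2 `^ (2 + eta).
have B10 : 0 <= B1 by rewrite mulr_ge0// mulr_ge0// powR_ge0.
have B20 : 0 <= B2 by rewrite mulr_ge0 ?powR_ge0// mulr_ge0// addr_ge0.
exists (B1 + B2); first exact: addr_ge0.
move=> U V Uout Uin Unear Vdec Vnear j k l y k2 l2.
have u1 : 1 <= 1 + `|y| by rewrite lerDl.
have u0 : 0 < 1 + `|y| by rewrite (lt_le_trans ltr01).
set w := (1 + `|y|) `^ (- (2 + eta)).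
have w0 : 0 <= w by exact: powR_ge0.
have p1 : 1 <= 2 ^+ j :> R by rewrite exprn_ege1// ler1n.
have c0 : 0 <= 2 `^ (j%:R * e) * (2 ^+ j) ^+ k :> R.
  by rewrite mulr_ge0 ?powR_ge0// exprn_ge0// exprn_ge0.
rewrite [`|_ * V l y|]normrM normrM (ger0_norm c0) mulrDl.
have [yeps|epsy] := leP `|y| eps; last first.
  rewrite -[leLHS]addr0; apply: lerD; last exact: mulr_ge0.
  have e2y : eps < `|2 ^+ j * y|.
    by rewrite normrM (lt_le_trans epsy)// ler_peMl// (le_trans p1)// ler_norm.
  have h1 : 2 `^ (j%:R * e) * (2 ^+ j) ^+ k * `|U k (2 ^+ j * y)| <=
      C * (eps `^ (- (d + 2)) * (1 + `|y|) `^ d).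
    apply: (@le_trans _ _ (C * `|y| `^ (- e - k%:R))).
      rewrite -(powR_dilate j k e y) mulrCA; apply: ler_wpM2l => //.
      exact: Uout.
    apply: ler_wpM2l => //; apply: powR_away0 => //; first exact: ltW.
    move: ed; rewrite ler_norml => /andP[de ed].
    have k2' : k%:R <= 2 :> R by rewrite ler_nat.
    have k0' : 0 <= k%:R :> R by [].
    by apply/andP; split; lra.
  apply: (@le_trans _ _ (C * (eps `^ (- (d + 2)) * (1 + `|y|) `^ d) *
      (Cp / (1 + `|y|) `^ (d + (2 + eta))))).
    by apply: ler_pM; [exact: mulr_ge0|exact: normr_ge0|exact: h1|exact: Vdec].
  have -> : w = (1 + `|y|) `^ d / (1 + `|y|) `^ (d + (2 + eta)).
    rewrite -powRN -powRD ?(gt_eqF u0) ?implybT// /w; congr (_ `^ _); ring.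
  by rewrite /B1 le_eqVlt; apply/orP; left; apply/eqP; ring.
rewrite -[leLHS]add0r; apply: lerD; first exact: mulr_ge0.
have y1 : `|y| <= 1 := le_trans yeps eps1.
have [[yz N3]|yN] := pselect (y = 0 /\ N <> 2%N).
  have -> : `|V l y| = 0.
    apply/eqP; rewrite eq_le normr_ge0 andbT (le_trans (Vnear l y l2 y1))//.
    rewrite yz normr0 expr0n mulr_ge0_le0// subn_eq0 leqNgt.
    rewrite (leq_ltn_trans l2)//=.
    by rewrite ltn_neqAle N2 andbT; apply/eqP => /esym.
  by rewrite mulr0 mulr_ge0.
have yN2 : y = 0 -> N = 2%N.
  by move=> yz; apply: contrapT => N3; exact: yN.
have pw (i : nat) : 0 <= `|y| ^+ i by exact: exprn_ge0.
have ylN : `|y| ^+ (N - l) <= `|y| ^+ (N - 2).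
  by rewrite ler_wiXn2l// leq_sub2l.
have h1 : 2 `^ (j%:R * e) * (2 ^+ j) ^+ k * `|U k (2 ^+ j * y)| <=
    (C + K0) / `|y| ^+ (N - 2).
  case: j p1 c0 => [|j] p1 c0.
    rewrite mul0r powRr0 expr0 expr1n !mul1r (le_trans (Unear k y k2 y1))//.
    have [y0|yn0] := eqVneq y 0; last first.
      rewrite ler_pdivlMr ?exprn_gt0 ?normr_gt0//.
      rewrite (@le_trans _ _ K0)// ?lerDr// ler_piMr// exprn_ile1//.
    by rewrite yN2// subnn expr0 divr1 lerDr.
  rewrite (le_trans (Uin j.+1 k y _ k2 yeps yN2))// ler_wpM2r ?invr_ge0//.
  by rewrite lerDl.
apply: (@le_trans _ _ ((C + K0) / `|y| ^+ (N - 2) * (K1 * `|y| ^+ (N - 2)))).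
  apply: ler_pM; [exact: mulr_ge0|exact: normr_ge0|exact: h1|].
  by rewrite (le_trans (Vnear l y l2 y1))// ler_wpM2l.
have yp : `|y| ^+ (N - 2) != 0.
  rewrite expf_eq0 negb_and normr_eq0.
  have [/yN2 ->|//] := eqVneq y 0; first by rewrite subnn.
  by rewrite orbT.
have -> : (C + K0) / `|y| ^+ (N - 2) * (K1 * `|y| ^+ (N - 2)) = (C + K0) * K1.
  by field.
rewrite /B2 -[leRHS]mulrA -[leLHS]mulr1; apply: ler_wpM2l.
  by rewrite mulr_ge0// addr_ge0.
rewrite /w powRN -ler_pdivrMr ?mul1r ?invr_gt0 ?powR_gt0// invrK.
by rewrite ge0_ler_powR ?nnegrE ?addr_ge0// -[leRHS]/(1 + 1) lerD2l.
Qed.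

End UniformBounds.

Section MultiplierTheorem.
Context {R : realType}.
Local Notation mu := (@lebesgue_measure R).
Local Notation Re := (@complex.Re R).
Local Notation Im := (@complex.Im R).
Implicit Types (u : R -> R) (f g H : R -> R[i]) (s t x y c d e eps B K : R) (j k l : nat).

Lemma inv_fourier0 : inv_fourier (fun=> 0) = fun=> 0 :> R[i].
Proof.
have z : L1 (fun=> 0 : R) by exact: integrable0.
apply: inv_fourier_eq.
- by apply/classC0; split=> t; exact: cvg_cst.
- by [].
move=> x; rewrite fourierE; have -> : (fun t : R => - Re 0) = fun=> 0.
  by apply/funext => t; rewrite /= oppr0.
by rewrite !trigT0.
Qed.

(** In the variable [y = x / 2 ^+ j] the multiplied function is, up to the factor
    [2 `^ (- (j%:R * e))], the dyadic dilate of a profile [G j] with transform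
    [M j y = 2 `^ (j%:R * e) * H (2 ^+ j * y) * fourier psi y].  The derivatives of
    [M j] up to order 2 are bounded uniformly in [j], and normalization removes
    the factor provided that the norms of the profiles stay away from 0.  That
    is seen at any frequency [y0] where [fourier psi] does not vanish; if there
    is none, all the functions are 0. *)
Lemma multiplier_vaguelets (psi H : R -> R[i]) (N : nat) e d eta Cp :
  (2 <= N)%N -> `|e| <= d -> 0 < eta -> 0 <= Cp ->
  cintegrable psi -> classC N (fourier psi) ->
  (forall m, (m < N)%N -> derive1n m (Re \o fourier psi) 0 = 0 /\
                          derive1n m (Im \o fourier psi) 0 = 0) ->
  (forall k x, (k <= 2)%N ->
     normc (cderive k (fourier psi) x) <= Cp / (1 + `|x|) `^ (d + (2 + eta))) ->
  classC 2 H ->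
  (forall eps, 0 < eps -> exists c C : R, [/\ 0 < c, 0 <= C,
    forall x, eps < `|x| -> c * `|x| `^ (- e) <= normc (H x),
    forall k x, (k <= 2)%N -> eps < `|x| ->
      normc (cderive k H x) <= C * `|x| `^ (- e - k%:R) &
    forall j k x, (1 <= j)%N -> (k <= 2)%N -> `|x| <= eps -> (x = 0 -> N = 2%N) ->
      2 `^ (j%:R * e) * (2 ^+ j) ^+ k * normc (cderive k H (2 ^+ j * x))
        <= C / `|x| ^+ (N - 2)]) ->
  vaguelets (fun (j : nat) (k : int) =>
    normalize (inv_fourier (fun x => H x * fourier (dyadic psi j k) x))).
Proof.
move=> N2 ed eta0 Cp0 ipsi psiC psi0 psidec HC Hb.
have N0 : (0 < N)%N := ltnW N2.
have psi00 : fourier psi 0 = 0.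
  by apply: complexP; [exact: (psi0 0%N N0).1|exact: (psi0 0%N N0).2].
have [[y0 psiy0]|psiN0] := pselect (exists y, fourier psi y <> 0); last first.
  apply: vaguelets0 => j k t; rewrite /normalize.
  rewrite (_ : (fun x => _) = fun=> 0) ?inv_fourier0 ?mul0r//.
  apply/funext => x; rewrite fourier_dyadic//.
  have -> : fourier psi (x / 2 ^+ j) = 0.
    by apply: contrapT => h; apply: psiN0; exists (x / 2 ^+ j).
  by rewrite !mulr0.
have y0N0 : y0 != 0 by apply/eqP => E; move: psiy0; rewrite E psi00.
(* All the points [2 ^+ j * y0] lie beyond [eps], where [H] is bounded below;
   [eps <= 1] allows powers of [`|y|] to be compared near 0. *)
pose eps := Num.min 1 (`|y0| / 2).
have y0_gt0 : 0 < `|y0| by rewrite normr_gt0.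
have eps0 : 0 < eps by rewrite lt_min ltr01 divr_gt0.
have eps1 : eps <= 1 by rewrite ge_min lexx.
have epsy0 : eps < `|y0|.
  by rewrite (@le_lt_trans _ _ (`|y0| / 2))// ?ge_min ?lexx ?orbT//; lra.
have [c [C [c0 C0 Hlow Hout Hin]]] := Hb _ eps0.
(* Multiplying [M j] below by [`|y| `^ al] costs at most the extra decay [eta]. *)
pose al := Num.min eta 2^-1.
have al0 : 0 < al by rewrite lt_min eta0 invr_gt0 ltr0n.
have al2 : al <= 2^-1 by rewrite ge_min lexx orbT.
have aleta : al <= eta by rewrite ge_min lexx.
pose Hr k := derive1n k (Re \o H); pose Hi k := derive1n k (Im \o H).
pose Pr k := derive1n k (Re \o fourier psi); pose Pi k := derive1n k (Im \o fourier psi).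
have [dHr cHr] := HC _ (or_introl erefl); have [dHi cHi] := HC _ (or_intror erefl).
have [dPr cPr] := psiC _ (or_introl erefl); have [dPi cPi] := psiC _ (or_intror erefl).
have jHr : jet2 Hr by exact: (jet2_classC _ dHr cHr).
have jHi : jet2 Hi by exact: (jet2_classC _ dHi cHi).
have jPr : jet2 Pr by exact: (jet2_classC N2 dPr cPr).
have jPi : jet2 Pi by exact: (jet2_classC N2 dPi cPi).
have Hr_le k x : `|Hr k x| <= normc (cderive k H x) by exact: (Re_le_normc (cderive k H x)).
have Hi_le k x : `|Hi k x| <= normc (cderive k H x) by exact: (Im_le_normc (cderive k H x)).
have Pr_le k x : `|Pr k x| <= normc (cderive k (fourier psi) x).
  exact: (Re_le_normc (cderive k (fourier psi) x)).
have Pi_le k x : `|Pi k x| <= normc (cderive k (fourier psi) x).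
  exact: (Im_le_normc (cderive k (fourier psi) x)).
have [K1r K1r0 HK1r] := @flat_derive1n R N _ 1 dPr cPr (fun m h => (psi0 m h).1).
have [K1i K1i0 HK1i] := @flat_derive1n R N _ 1 dPi cPi (fun m h => (psi0 m h).2).
have bnd (U : nat -> R -> R) : jet2 U ->
    exists2 K0 : R, 0 <= K0 & forall k x, (k <= 2)%N -> `|x| <= 1 -> `|U k x| <= K0.
  move=> [d0 d1 cU2].
  have [Ka Ka0 Ha] := continuous_bounded 1 (der_continuous d0).
  have [Kb Kb0 Hb'] := continuous_bounded 1 (der_continuous d1).
  have [Kc Kc0 Hc] := continuous_bounded 1 cU2.
  exists (Ka + Kb + Kc); first by rewrite !addr_ge0.
  move=> [|[|[|//]]] x _ x1.
  - by move: (Ha x x1) Ka0 Kb0 Kc0; clear; lra.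
  - by move: (Hb' x x1) Ka0 Kb0 Kc0; clear; lra.
  - by move: (Hc x x1) Ka0 Kb0 Kc0; clear; lra.
have [K0r K0r0 HK0r] := bnd _ jHr; have [K0i K0i0 HK0i] := bnd _ jHi.
pose K0 := K0r + K0i; pose K1 := K1r + K1i.
have K00 : 0 <= K0 by exact: addr_ge0.
have K10 : 0 <= K1 by exact: addr_ge0.
have eps01 : 0 < eps <= 1 by rewrite eps0.
have [B B0 HB] := rescaled_product_bound N2 eps01 ed (ltW eta0) Cp0 C0 K00 K10.
have outU (U : nat -> R -> R) : (forall k x, `|U k x| <= normc (cderive k H x)) ->
    forall k x, (k <= 2)%N -> eps < `|x| -> `|U k x| <= C * `|x| `^ (- e - k%:R).
  by move=> hU k x k2 ex; rewrite (le_trans (hU k x))// Hout.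
have inU (U : nat -> R -> R) : (forall k x, `|U k x| <= normc (cderive k H x)) ->
    forall j k x, (1 <= j)%N -> (k <= 2)%N -> `|x| <= eps -> (x = 0 -> N = 2%N) ->
    2 `^ (j%:R * e) * (2 ^+ j) ^+ k * `|U k (2 ^+ j * x)| <= C / `|x| ^+ (N - 2).
  move=> hU j k x j1 k2 xe xN; rewrite (le_trans _ (Hin j k x j1 k2 xe xN))//.
  by rewrite ler_wpM2l// mulr_ge0 ?powR_ge0// !exprn_ge0.
have decV (V : nat -> R -> R) : (forall k x, `|V k x| <= normc (cderive k (fourier psi) x)) ->
    forall l y, (l <= 2)%N -> `|V l y| <= Cp / (1 + `|y|) `^ (d + (2 + eta)).
  by move=> hV l y l2; rewrite (le_trans (hV l y))// psidec.
have nHr k x : (k <= 2)%N -> `|x| <= 1 -> `|Hr k x| <= K0.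
  by move=> k2 x1; rewrite (le_trans (HK0r k x k2 x1))// lerDl.
have nHi k x : (k <= 2)%N -> `|x| <= 1 -> `|Hi k x| <= K0.
  by move=> k2 x1; rewrite (le_trans (HK0i k x k2 x1))// lerDr.
have nPr l y : (l <= 2)%N -> `|y| <= 1 -> `|Pr l y| <= K1 * `|y| ^+ (N - l).
  move=> l2 y1; rewrite (le_trans (HK1r l y (leq_trans l2 N2) y1))//.
  by rewrite ler_wpM2r ?exprn_ge0// lerDl.
have nPi l y : (l <= 2)%N -> `|y| <= 1 -> `|Pi l y| <= K1 * `|y| ^+ (N - l).
  move=> l2 y1; rewrite (le_trans (HK1i l y (leq_trans l2 N2) y1))//.
  by rewrite ler_wpM2r ?exprn_ge0// lerDr.
pose SU (U : nat -> R -> R) j k y := 2 `^ (j%:R * e) * (2 ^+ j) ^+ k * U k (2 ^+ j * y).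
pose w y := (1 + `|y|) `^ (- (2 + eta)).
have Brr j k l y : (k <= 2)%N -> (l <= 2)%N -> `|SU Hr j k y * Pr l y| <= B * w y.
  exact: (HB _ _ (outU _ Hr_le) (inU _ Hr_le) nHr (decV _ Pr_le) nPr).
have Bri j k l y : (k <= 2)%N -> (l <= 2)%N -> `|SU Hr j k y * Pi l y| <= B * w y.
  exact: (HB _ _ (outU _ Hr_le) (inU _ Hr_le) nHr (decV _ Pi_le) nPi).
have Bir j k l y : (k <= 2)%N -> (l <= 2)%N -> `|SU Hi j k y * Pr l y| <= B * w y.
  exact: (HB _ _ (outU _ Hi_le) (inU _ Hi_le) nHi (decV _ Pr_le) nPr).
have Bii j k l y : (k <= 2)%N -> (l <= 2)%N -> `|SU Hi j k y * Pi l y| <= B * w y.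
  exact: (HB _ _ (outU _ Hi_le) (inU _ Hi_le) nHi (decV _ Pi_le) nPi).
have wl y : B * w y <= B * lorentz y.
  by rewrite ler_wpM2l// powR_decay_lorentz// ltW.
pose M j y := (2 `^ (j%:R * e))%:C * H (2 ^+ j * y) * fourier psi y.
have ReM j y : Re (M j y) = SU Hr j 0%N y * Pr 0%N y + (- 1) * (SU Hi j 0%N y * Pi 0%N y).
  rewrite /M /SU -[Hr 0%N _]/(Re (H (2 ^+ j * y))) -[Hi 0%N _]/(Im (H (2 ^+ j * y))).
  rewrite -[Pr 0%N y]/(Re (fourier psi y)) -[Pi 0%N y]/(Im (fourier psi y)).
  by case: (H (2 ^+ j * y)) => a b; case: (fourier psi y) => a' b' /=; ring.
have ImM j y : Im (M j y) = SU Hr j 0%N y * Pi 0%N y + 1 * (SU Hi j 0%N y * Pr 0%N y).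
  rewrite /M /SU -[Hr 0%N _]/(Re (H (2 ^+ j * y))) -[Hi 0%N _]/(Im (H (2 ^+ j * y))).
  rewrite -[Pr 0%N y]/(Re (fourier psi y)) -[Pi 0%N y]/(Im (fourier psi y)).
  by case: (H (2 ^+ j * y)) => a b; case: (fourier psi y) => a' b' /=; ring.
have CRe j : C2_le (8 * B) (Re \o M j).
  have -> : Re \o M j = fun y => SU Hr j 0%N y * Pr 0%N y + (- 1) * (SU Hi j 0%N y * Pi 0%N y).
    by apply/funext => y; exact: ReM.
  apply: (C2_le_jets (s := - 1) _ (jet2_dilate _ _ jHr) jPr (jet2_dilate _ _ jHi) jPi).
    by rewrite normrN1.
  by move=> k l y k2 l2; split; apply: le_trans (wl y); [exact: Brr|exact: Bii].
have CIm j : C2_le (8 * B) (Im \o M j).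
  have -> : Im \o M j = fun y => SU Hr j 0%N y * Pi 0%N y + 1 * (SU Hi j 0%N y * Pr 0%N y).
    by apply/funext => y; exact: ImM.
  apply: (C2_le_jets (s := 1) _ (jet2_dilate _ _ jHr) jPi (jet2_dilate _ _ jHi) jPr).
    by rewrite normr1.
  by move=> k l y k2 l2; split; apply: le_trans (wl y); [exact: Bri|exact: Bir].
have Mal j y : `|y| `^ al * normc (M j y) <= 8 * B * lorentz y.
  apply: (@le_trans _ _ (`|y| `^ al * (4 * B * w y))).
    rewrite ler_wpM2l ?powR_ge0// (le_trans (normc_le _))// ReM ImM mulN1r mul1r.
    have h1 := ler_normB (SU Hr j 0%N y * Pr 0%N y) (SU Hi j 0%N y * Pi 0%N y).
    have h2 := ler_normD (SU Hr j 0%N y * Pi 0%N y) (SU Hi j 0%N y * Pr 0%N y).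
    have := Brr j 0%N 0%N y isT isT; have := Bii j 0%N 0%N y isT isT.
    have := Bri j 0%N 0%N y isT isT; have := Bir j 0%N 0%N y isT isT.
    by move: h1 h2; rewrite -[4 * B * w y]mulrA; clear; lra.
  have := @powR_decay_holder R al eta y; rewrite ltW// => /(_ aleta) h.
  have lB : 0 <= B * lorentz y by rewrite mulr_ge0 ?lorentz_ge0.
  have : B * (`|y| `^ al * w y) <= B * lorentz y by rewrite ler_wpM2l.
  have -> : `|y| `^ al * (4 * B * w y) = 4 * (B * (`|y| `^ al * w y)) by ring.
  by rewrite -[8 * B * lorentz y]mulrA; move: lB; clear; lra.
have al01 : 0 < al <= 1 by rewrite al0 (le_trans al2)// invf_le1 ?ler1n.
have /choice[G HG] : forall j, exists G : R -> R[i], [/\ classC 0 G, fourier G =1 M j,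
    forall t, normc (G t) <= 4 * (8 * B) * lorentz t &
    forall s t, normc (G s - G t) <= 4 * (8 * B) * `|s - t| `^ al].
  by move=> j; exact: (inverse_fourier_C2 al01 (CRe j) (CIm j) (Mal j)).
have GC j : classC 0 (G j) by have [] := HG j.
have GM j : fourier (G j) =1 M j by have [] := HG j.
have GK j t : normc (G j t) <= 4 * (8 * B) * lorentz t by have [] := HG j.
have Gal j s t : normc (G j s - G j t) <= 4 * (8 * B) * `|s - t| `^ al by have [] := HG j.
have mG j : measurable_fun setT (Re \o G j) /\ measurable_fun setT (Im \o G j).
  by have /classC0[cr ci] := GC j; split; exact: continuous_measurable_fun.
have iG j : cintegrable (G j).
  have [mr mi] := mG j; split.
    apply: (L1_le mr (L1Zl (4 * (8 * B)) L1_lorentz)) => t.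
    by rewrite (le_trans (Re_le_normc _)).
  apply: (L1_le mi (L1Zl (4 * (8 * B)) L1_lorentz)) => t.
  by rewrite (le_trans (Im_le_normc _)).
have iG2 j : L1 (fun t => normc (G j t) ^+ 2).
  by have [mr mi] := mG j; exact: (L1_normc_sqr (measurable_normc mr mi) (GK j)).
have M0 j : M j 0 = 0 by rewrite /M psi00 mulr0.
have npsi0 : 0 < normc (fourier psi y0).
  rewrite lt_neqAle normc_ge0 andbT eq_sym; apply/eqP => /eq0_normc; exact: psiy0.
pose c1 := c * `|y0| `^ (- e) * normc (fourier psi y0).
have c10 : 0 < c1 by rewrite !mulr_gt0// powR_gt0.
have Mlow j : c1 <= normc (M j y0).
  have pe : eps < `|2 ^+ j * y0|.
    rewrite normrM (lt_le_trans epsy0)// ler_peMl//.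
    by rewrite ger0_norm ?exprn_ge0// exprn_ege1// ler1n.
  rewrite /M !normcM normc_real ger0_norm ?powR_ge0//.
  rewrite /c1 ler_wpM2r ?normc_ge0//.
  have <- : 2 `^ (j%:R * e) * (c * `|2 ^+ j * y0| `^ (- e)) = c * `|y0| `^ (- e).
    have := powR_dilate j 0 e y0; rewrite expr0 mulr1 subr0 => <-; ring.
  by rewrite ler_wpM2l ?powR_ge0// Hlow.
have K320 : 0 <= 4 * (8 * B) by rewrite !mulr_ge0.
have [nu nu0 Hnu] := L2norm_lower K320 c10.
have nuG j : nu <= L2norm (G j).
  by have [mr mi] := mG j; apply: Hnu => //; exists y0; rewrite GM.
have al02 : 0 < al <= 2^-1 by rewrite al0.
apply: (vaguelets_of_profiles al02 nu0 iG _ GK Gal nuG) => [j k|j k t].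
  by rewrite -fourier0 fourier_dyadic// mul0r GM M0 mulr0.
have lam0 : 0 < 2 `^ (- (j%:R * e)) :> R by exact: powR_gt0.
have lamE : 2 `^ (- (j%:R * e)) * 2 `^ (j%:R * e) = 1 :> R.
  by rewrite powRN mulVf// gt_eqF// powR_gt0.
set lam := 2 `^ (- (j%:R * e)) in lam0 lamE.
have -> : inv_fourier (fun x => H x * fourier (dyadic psi j k) x) =
    fun t => lam%:C * dyadic (G j) j k t.
  apply: inv_fourier_eq.
  - exact/classC0Z/classC0_dyadic.
  - exact/cintegrableZ/cintegrable_dyadic.
  move=> x; rewrite fourierZ; last exact: cintegrable_dyadic.
  rewrite !fourier_dyadic// GM /M.
  have -> : 2 ^+ j * (x / 2 ^+ j) = x by rewrite mulrC divfK// dilation_neq0.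
  set E := _%:C * expi _; set P := fourier psi _.
  have lamEC : lam%:C * (2 `^ (j%:R * e))%:C = 1 :> R[i] by rewrite -rmorphM /= lamE.
  have -> : lam%:C * (E * ((2 `^ (j%:R * e))%:C * H x * P)) =
     (lam%:C * (2 `^ (j%:R * e))%:C) * (H x * (E * P)) by ring.
  by rewrite lamEC mul1r.
have i2 : L1 (fun t => normc (dyadic (G j) j k t) ^+ 2).
  exact: L1_dyadic_sqr.
rewrite /normalize L2normZ ?(ltW lam0)// L2norm_dyadic//.
rewrite rmorphM /= -mulf_div divff ?mul1r//.
by rewrite eq_complex /= negb_and gt_eqF.
Qed.

End MultiplierTheorem.

(** * Conjugate multipliers and flatness at the origin *)

Section Conjugation.
Context {R : realType}.
Local Notation Re := (@complex.Re R).
Local Notation Im := (@complex.Im R).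
Implicit Types (u : R -> R) (f : R -> R[i]) (x : R).

Lemma derive1nN (n : nat) u :
  (forall m x, (m < n)%N -> derivable (derive1n m u) x 1) ->
  derive1n n (fun x => - u x) = (fun x => - derive1n n u x).
Proof.
elim: n => [//|n IH] du.
rewrite !derive1nS IH => [|m x mn]; last by apply: du; exact: ltnW.
apply/funext => x; rewrite !derive1E.
have d := derivableP (du n x (ltnSn n)).
by have dN := derN d; rewrite derive_val.
Qed.

Lemma Re_conjc f : Re \o (fun x => conjc (f x)) = Re \o f.
Proof. by apply/funext => x /=; case: (f x). Qed.

Lemma Im_conjc f : Im \o (fun x => conjc (f x)) = fun x => - (Im \o f) x.
Proof. by apply/funext => x /=; case: (f x). Qed.

Lemma classC_conjc (n : nat) f : classC n f -> classC n (fun x => conjc (f x)).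
Proof.
move=> fC u [->|->]; rewrite ?Re_conjc ?Im_conjc; first exact: fC (or_introl erefl).
have [du cu] := fC _ (or_intror erefl).
have E m : (m <= n)%N -> derive1n m (fun x => - (Im \o f) x) = fun x => - derive1n m (Im \o f) x.
  by move=> mn; apply: derive1nN => i x im; apply: du; exact: leq_trans mn.
split=> [m x mn|]; last by rewrite (E n (leqnn n)) => x; exact: cvgN (cu x).
rewrite (E m (ltnW mn)); have d := derivableP (du m x mn).
by have dN := derN d; exact: ex_derive.
Qed.

Lemma normc_conjc (z : R[i]) : normc (conjc z) = normc z.
Proof. by case: z => a b /=; rewrite sqrrN. Qed.

Lemma normc_cderive_conjc (n k : nat) f x : classC n f -> (k <= n)%N ->
  normc (cderive k (fun y => conjc (f y)) x) = normc (cderive k f x).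
Proof.
move=> fC kn; rewrite /cderive Re_conjc Im_conjc.
have [du _] := fC _ (or_intror erefl).
rewrite derive1nN; last by move=> i y ik; apply: du; exact: leq_trans kn.
by rewrite /= sqrrN.
Qed.

(** The decay makes all moments up to order [N] finite, so that the transform
    may be differentiated under the integral at 0. *)
Lemma fourier_flat0 (psi : R -> R[i]) (N : nat) : L2 psi ->
  (exists C T : R, forall t, T <= `|t| ->
     normc (psi t) <= C * (1 + t ^+ 2) `^ (- (N%:R / 2) - 1)) ->
  (forall nu : nat, (nu < N)%N -> cintegral (fun t => (t ^+ nu)%:C * psi t) = 0) ->
  cintegrable psi /\
  (forall m, (m < N)%N -> derive1n m (Re \o fourier psi) 0 = 0 /\
                          derive1n m (Im \o fourier psi) 0 = 0).
Proof.
move=> [r2 i2] [C [T dec]] mom.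
have ir n : (n <= N)%N -> L1 (fun t => t ^+ n * (Re \o psi) t).
  move=> nN; apply: (@L1_moment R _ n N C T r2 nN) => t Tt.
  exact: le_trans (Re_le_normc _) (dec t Tt).
have ii n : (n <= N)%N -> L1 (fun t => t ^+ n * (Im \o psi) t).
  move=> nN; apply: (@L1_moment R _ n N C T i2 nN) => t Tt.
  exact: le_trans (Im_le_normc _) (dec t Tt).
split.
  by split; [apply: eq_L1 (ir 0%N (leq0n N))|apply: eq_L1 (ii 0%N (leq0n N))] => t; rewrite mul1r.
move=> m mN.
have [mr mi] : \int[lebesgue_measure]_t (t ^+ m * (Re \o psi) t) = 0 /\
    \int[lebesgue_measure]_t (t ^+ m * (Im \o psi) t) = 0.
  have [Er Ei] := mom m mN; split.
    by rewrite -[RHS]Er; apply: eq_int => t; rewrite ReZ.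
  by rewrite -[RHS]Ei; apply: eq_int => t; rewrite ImZ.
have -> : Re \o fourier psi = trigT (Re \o psi) (Im \o psi).
  by apply/funext => x; rewrite -[LHS]/(Re (fourier psi x)) fourierE.
have -> : Im \o fourier psi = trigT (Im \o psi) (fun t => - (Re \o psi) t).
  by apply/funext => x; rewrite -[LHS]/(Im (fourier psi x)) fourierE.
split; apply: derive1n_trigT0 => //.
- by move=> i im; split; [apply: ir|apply: ii]; exact: leq_trans im (ltnW mN).
- move=> i im; have iN : (i <= N)%N by exact: leq_trans im (ltnW mN).
  by split; [exact: ii|apply: eq_L1 (L1N (ir i iN)) => t; rewrite mulrN].
- rewrite -[RHS]oppr0 -mr -intN; last exact: ir (ltnW mN).
  by apply: eq_int => t; rewrite mulrN.
Qed.

End Conjugation.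

Theorem theorem2p1 (R : realType) (psi : R -> R[i]) (N : nat)
    (h2 : R -> R[i]) (d : R)
    (psi_wavelet : mra_wavelet psi)
    (N_ge2 : (2 <= N)%N)
    (h2_herm : forall x, h2 x = conjc (h2 (- x)))
    (h2_neq0 : forall x, h2 x != 0)
    (h2_C2 : classC 2 h2)
    (h2V_C2 : classC 2 (fun x => (h2 x)^-1))
    (h2_bounds : forall eps : R, 0 < eps -> exists C1 C2 C3 : R,
       [/\ 0 < C1, C1 <= C2, 0 < C3 &
       [/\ forall x, eps < `|x| ->
             C1 * `|x| `^ (- d) <= normc (h2 x) <= C2 * `|x| `^ (- d),
           forall (p : int) (k : nat) x,
             p \in [:: -1; 1] -> k \in [:: 1; 2]%N -> eps < `|x| ->
             normc (cderive k (fun y => h2 y ^ p) x)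
               <= C3 * `|x| `^ (- (p%:~R * d) - k%:R) &
           forall (j : nat) x, (1 <= j)%N -> `|x| <= eps ->
             (x = 0 -> N = 2%N) ->
             forall (p : int) (k : nat),
             p \in [:: -1; 1] -> k \in [:: 0; 1; 2]%N ->
             (2 `^ (- (p%:~R * j%:R * d)))^-1 * 2 ^+ (j * k)
               * normc (cderive k (fun y => h2 y ^ p) (2 ^+ j * x))
               <= C3 / `|x| ^+ (N - 2)]])
    (psi_decay : exists C T : R, forall t, T <= `|t| ->
       normc (psi t) <= C * (1 + t ^+ 2) `^ (- (N%:R / 2) - 1))
    (psi_moments : forall nu : nat, (nu < N)%N ->
       cintegral (fun t => (t ^+ nu)%:C * psi t) = 0)
    (N_ge : Num.max 2 (- 2^-1 + `|d|) <= N%:R)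
    (fpsi_CN : classC N (fourier psi))
    (fpsi_bounds : exists eta C : R, [/\ 0 < eta, 0 < C &
       forall (k : nat) x, k \in [:: 0; 1; 2]%N ->
         normc (cderive k (fourier psi) x)
           <= C / (1 + `|x|) `^ (`|d| + (2 + eta))]) :
  vaguelets (Psi_lower h2 psi) /\ vaguelets (Psi_upper h2 psi).
Proof.
have psi2 : L2 psi.
  have [V [phi [[Vj _ _ _ _] V1 _]]] := psi_wavelet.
  by have [[VL2 _ _ _] _] := Vj 1; exact: VL2.
have [ipsi flat] := fourier_flat0 psi2 psi_decay psi_moments.
have [eta [Cp [eta0 Cp0 dec]]] := fpsi_bounds.
have in3 k : (k <= 2)%N -> k \in [:: 0; 1; 2]%N by case: k => [|[|[|]]].
have in2 k : (0 < k)%N -> (k <= 2)%N -> k \in [:: 1; 2]%N by case: k => [|[|[|]]].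
have dec' k x : (k <= 2)%N ->
    normc (cderive k (fourier psi) x) <= Cp / (1 + `|x|) `^ (`|d| + (2 + eta)).
  by move=> k2; exact: dec (in3 k k2).
have h1E : (fun y => h2 y ^ (1 : int)) = h2 by apply/funext => y; rewrite expr1z.
have hVE : (fun y => h2 y ^ (-1 : int)) = fun y => (h2 y)^-1.
  by apply/funext => y; rewrite exprN1.
split.
  apply: (multiplier_vaguelets N_ge2 (lexx _) eta0 (ltW Cp0) ipsi fpsi_CN flat dec' h2_C2).
  move=> eps eps0; have [C1 [C2 [C3 [C10 C12 C30 [amp der near]]]]] := h2_bounds _ eps0.
  have C20 : 0 < C2 := lt_le_trans C10 C12.
  exists C1, (C2 + C3); split => //; first by rewrite addr_ge0 ?ltW.
  - by move=> x /amp /andP[].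
  - move=> [|k] x k2 ex.
      rewrite subr0 -[cderive 0 h2 x]/(complex.Re (h2 x) +i* complex.Im (h2 x)).
      have /andP[_ h] := amp x ex.
      have -> : complex.Re (h2 x) +i* complex.Im (h2 x) = h2 x by case: (h2 x).
      by rewrite (le_trans h)// ler_wpM2r ?powR_ge0// lerDl ltW.
    have := der 1 k.+1 x isT (in2 k.+1 isT k2) ex; rewrite h1E mul1r => h.
    by rewrite (le_trans h)// ler_wpM2r ?powR_ge0// lerDr ltW.
  - move=> j k x j1 k2 xe xN.
    have := near j x j1 xe xN 1 k isT (in3 k k2).
    rewrite h1E mul1r powRN invrK exprM => h.
    by rewrite (le_trans h)// ler_wpM2r ?invr_ge0 ?exprn_ge0// lerDr ltW.
(* The dual family has the multiplier [conjc (h2 x)^-1], of growth exponent [d]. *)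
have ed : `|- d| <= `|d| by rewrite normrN.
apply: (multiplier_vaguelets N_ge2 ed eta0 (ltW Cp0) ipsi fpsi_CN flat dec'
  (classC_conjc h2V_C2)).
move=> eps eps0; have [C1 [C2 [C3 [C10 C12 C30 [amp der near]]]]] := h2_bounds _ eps0.
have C20 : 0 < C2 := lt_le_trans C10 C12.
have ampV x : eps < `|x| -> C2^-1 * `|x| `^ (- - d) <= normc (h2 x)^-1 <= C1^-1 * `|x| `^ (- - d).
  move=> ex; have x0 : 0 < `|x| := lt_trans eps0 ex.
  have p0 : 0 < `|x| `^ (- d) by exact: powR_gt0.
  have /andP[lo hi] := amp x ex.
  have n0 : 0 < normc (h2 x) by rewrite (lt_le_trans _ lo)// mulr_gt0.
  rewrite normcV [_ `^ (- - d)]powRN -!invfM.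
  by rewrite !lef_pV2 ?posrE ?mulr_gt0// hi lo.
exists C2^-1, (C1^-1 + C3); split.
- by rewrite invr_gt0.
- by rewrite addr_ge0 ?invr_ge0 ?ltW.
- by move=> x ex; rewrite normc_conjc; have /andP[] := ampV x ex.
- move=> k x k2 ex; rewrite (normc_cderive_conjc _ h2V_C2)//.
  case: k k2 => [|k] k2.
    rewrite subr0; have /andP[_ h] := ampV x ex.
    rewrite -[cderive 0 _ x]/(complex.Re (h2 x)^-1 +i* complex.Im (h2 x)^-1).
    have -> : complex.Re (h2 x)^-1 +i* complex.Im (h2 x)^-1 = (h2 x)^-1 by case: ((h2 x)^-1).
    by rewrite (le_trans h)// ler_wpM2r ?powR_ge0// lerDl ltW.
  have := der (-1) k.+1 x isT (in2 k.+1 isT k2) ex; rewrite hVE mulN1r => h.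
  by rewrite (le_trans h)// ler_wpM2r ?powR_ge0// lerDr invr_ge0 ltW.
- move=> j k x j1 k2 xe xN; rewrite (normc_cderive_conjc _ h2V_C2)//.
  have := near j x j1 xe xN (-1) k isT (in3 k k2).
  rewrite hVE mulN1r mulNr powRN invrK exprM mulrN => h.
  by rewrite (le_trans h)// ler_wpM2r ?invr_ge0 ?exprn_ge0// lerDr invr_ge0 ltW.
Qed.
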